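(* Assume that $\mathbb{E}\{\|w_t\|_2^4\}<\infty$ and $\mathbb{E}\{\|\epsilon_t\|_2^4\}<\infty$ for every $t\in\mathbb{N}$, and fix $\mu_s>0$, $\mu_o>0$. Then for all $t\in\{1,\dots,N\}$, $N\in\mathbb{N}$, the optimal cost-to-go can be expressed as $$\mathcal{L}^*(\mathscr{F}_t;\mu_{s,o})=\widehat x_{t|t}^\top V_t\widehat x_{t|t}+2\widehat x_{t|t}^\top T_t\bar w+\widehat x_{t|t}^\top S_t\mathrm{M}_{\mu_{s,o}}+p_t,$$ and the risk-averse optimal controller reads $$u^*_{t-1}(\mu_{s,o})=K_{t-1}\widehat x_{t-1|t-1}+h_{t-1}+l_{t-1},$$ where $$K_{t-1}=-(B^\top V_tB+R)^{-1}B^\top V_tA,\quad h_{t-1}=-(B^\top V_tB+R)^{-1}B^\top(V_t+T_t)\bar w,\quad l_{t-1}=-\tfrac12(B^\top V_tB+R)^{-1}B^\top S_t\mathrm{M}_{\mu_{s,o}},$$ and the following backward recursions hold: $$V_{t-1}=A^\top V_tA+Q_{\mu_{s,o}}-A^\top V_tB(B^\top V_tB+R)^{-1}B^\top V_tA,$$ $$T_{t-1}=(A+BK_{t-1})^\top(V_t+T_t),\qquad S_{t-1}=(A+BK_{t-1})^\top S_t+I,$$ $$\begin{aligned}p_{t-1}={}&p_t-(h_{t-1}+l_{t-1})^\top(B^\top V_tB+R)(h_{t-1}+l_{t-1})+\bar w^\top(V_t+2T_t)\bar w+\bar w^\top S_t\mathrm{M}_{\mu_{s,o}}+\mathrm{tr}(Q_{\mu_{s,o}}\Sigma_{t|t})\\&-2\,\mathrm{tr}(V_tH_{t|t-1})+\mathrm{tr}(A^\top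 V_tA\,\Sigma_{t-1|t-1})+\mathrm{tr}(V_tW),\end{aligned}$$ starting from $V_N=Q_{\mu_{s,o}}$, $S_N=I$, $T_N=0$ and $p_N=\mathrm{tr}(Q_{\mu_{s,o}}\Sigma_{N|N})$.
   Context: System: $x_t\in\mathbb{R}^n$ (hidden state), $u_t\in\mathbb{R}^m$ (control), $y_t\in\mathbb{R}^q$ (output), with $x_{t+1}=Ax_t+Bu_t+w_{t+1}$ and $y_t=Cx_t+\epsilon_t$, where $A,B,C$ are constant real matrices. The process noise $w_t$ and the output noise $\epsilon_t$ are i.i.d. stochastic sequences, not necessarily Gaussian, with $\mathbb{E}\{w_t\}=\bar w$, $\mathbb{E}\{\epsilon_t\}=\bar\epsilon$, $W=\mathbb{E}\{(w_t-\bar w)(w_t-\bar w)^\top\}$, $E=\mathbb{E}\{(\epsilon_t-\bar\epsilon)(\epsilon_t-\bar\epsilon)^\top\}$, $H=\mathbb{E}\{(w_t-\bar w)(\epsilon_t-\bar\epsilon)^\top\}$. $\mathscr{F}_t=\sigma(y_{0:t},u_{0:t-1})$, and $\mathcal{L}_2(\mathscr{F}_t)$ is the space of square-integrable $\mathscr{F}_t$-measurable random vectors. $N$ is the horizon; $Q,Q_s,Q_o$ are positive semidefinite and $R$ is positive definite. Estimates and errors: $\widehat x_{t|t}=\mathbb{E}\{x_t|\mathscr{F}_t\}$, $\widehat x_{t|t-1}=\mathbb{E}\{x_t|\mathscr{F}_{t-1}\}$, $e_t=x_t-\widehat x_{t|t}$, $\rho_t=x_t-\widehat x_{t|t-1}$,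 $\Sigma_{t|t}=\mathbb{E}\{e_te_t^\top|\mathscr{F}_t\}$, $H_{t|t-1}=\mathbb{E}\{e_t\rho_t^\top|\mathscr{F}_{t-1}\}$. Noise statistics: with $\delta_t=w_t-\bar w$ and $d_t=C(w_t-\bar w)+\epsilon_t-\bar\epsilon$, set $\mathrm{M}_w=\mathbb{E}\{\delta_t\delta_t^\top Q_s\delta_t\}$, $\mathrm{M}=\mathbb{E}\{d_td_t^\top Q_od_t\}$, $P=CWC^\top+CH+(CH)^\top+E$. For multipliers $\mu_{s,o}=(\mu_s,\mu_o)$ set $$Q_{\mu_{s,o}}=Q+4\mu_sQ_sWQ_s+4\mu_oC^\top Q_oPQ_oC,\qquad \mathrm{M}_{\mu_{s,o}}=4\mu_sQ_s\mathrm{M}_w+4\mu_o\big(C^\top Q_o\mathrm{M}+2C^\top Q_oPQ_o\bar\epsilon\big).$$ Lagrangian: up to an additive term not depending on $u$, $$\mathcal{L}(u;\mu_{s,o})=\mathbb{E}\Big\{g_N(x_N)+\sum_{t=0}^{N-1}g(x_t,u_t)\Big\},$$ with $g_N(x)=x^\top Q_{\mu_{s,o}}x+x^\top\mathrm{M}_{\mu_{s,o}}$ and $g(x,u)=x^\top Q_{\mu_{s,o}}x+x^\top\mathrm{M}_{\mu_{s,o}}+u^\top Ru$. It is the Lagrangian of the problem of minimizing $\mathbb{E}\{x_N^\top Qx_N+\sum_{t=0}^{N-1}(x_t^\top Qx_t+u_t^\top Ru_t)\}$ over $u_t\in\mathcal{L}_2(\mathscr{F}_t)$ subject to upper bounds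 on the cumulative expected predictive variances of $x_t^\top Q_sx_t$ and $y_t^\top Q_oy_t$ (prediction conditioned on $\sigma(y_{0:t-1},u_{0:t-2},x_{0:t-1})$), with multipliers $\mu_s,\mu_o$. The risk-averse optimal controller is the minimizer of this Lagrangian over $u_t\in\mathcal{L}_2(\mathscr{F}_t)$, $t=0,\dots,N-1$. The optimal cost-to-go is $$\mathcal{L}^*(\mathscr{F}_k;\mu_{s,o})=\inf_{u_{k:N-1}}\mathbb{E}\Big\{g_N(x_N)+\sum_{t=k}^{N-1}g(x_t,u_t)\,\Big|\,\mathscr{F}_k\Big\},$$ the infimum being over $u_t\in\mathcal{L}_2(\mathscr{F}_t)$, $t=k,\dots,N-1$.
   Formalization: The p recursion is corrected: E{p_t+tr(V_t Σ_{t|t})|F_{t-1}}+tr(Q_μ Σ_{t-1|t-1}) replaces p_t+tr(Q_μ Σ_{t|t}); the printed one fails (A=Q=R=1, B=C=0, no noise, x_0=±1, N=2). x_0 is square-integrable and independent of the noise; pairs (w_t,ε_t) are i.i.d. *)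

(* Defs.v *)
From HB Require Import structures.
From mathcomp Require Import all_boot all_order all_algebra.
From mathcomp Require Import all_classical all_reals all_analysis.

Set Implicit Arguments.
Unset Strict Implicit.
Unset Printing Implicit Defensive.

Import Order.TTheory GRing.Theory Num.Theory.
Import numFieldNormedType.Exports.

Local Open Scope classical_set_scope.
Local Open Scope ring_scope.

Definition qform (R : realType) (n : nat) (M : 'M[R]_n) (x : 'cV[R]_n) : R :=
  (x^T *m M *m x) 0 0.

Definition dotv (R : realType) (n : nat) (x y : 'cV[R]_n) : R :=
  (x^T *m y) 0 0.

Definition norm2 (R : realType) (n : nat) (x : 'cV[R]_n) : R :=
  Num.sqrt (\sum_i x i 0 ^+ 2).

Definition possemidef (R : realType) (n : nat) (M : 'M[R]_n) : Prop :=
  M^T = M /\ forall x : 'cV[R]_n, 0 <= qform M x.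

Definition posdef (R : realType) (n : nat) (M : 'M[R]_n) : Prop :=
  M^T = M /\ forall x : 'cV[R]_n, x != 0 -> 0 < qform M x.

(* The Borel sigma-algebra of a matrix space, as the product sigma-algebra of
   its entries. *)
Definition mx_borel (R : realType) (m n : nat) : set (set 'M[R]_(m, n)) :=
  <<s [set A : set 'M[R]_(m, n) | exists i j, exists2 D : set R,
         measurable D & A = [set M : 'M[R]_(m, n) | D (M i j)]] >>.

Definition sigma_of (R : realType) (T : Type) (m n : nat)
    (X : T -> 'M[R]_(m, n)) : set (set T) :=
  preimage_set_system setT X (@mx_borel R m n).

Definition mx_measurable (R : realType) (T : Type) (m n : nat)
    (G : set (set T)) (X : T -> 'M[R]_(m, n)) : Prop :=
  sigma_of X `<=` G.

Section Probability.
Context {R : realType} {d : measure_display} {T : measurableType d}.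
Context (P : probability T R).

(* Junk value 0 at the entries whose expectation is infinite or undefined. *)
Definition expect_mx (m n : nat) (X : T -> 'M[R]_(m, n)) : 'M[R]_(m, n) :=
  \matrix_(i, j) fine 'E_P[fun om => X om i j].

(* G is meant to be a sub-sigma-algebra of measurable. *)
Definition is_cond_expect (G : set (set T)) (X Z : T -> R) : Prop :=
  [/\ preimage_set_system setT Z measurable `<=` G,
      P.-integrable setT (EFin \o Z) &
      forall A, G A ->
        \int[P]_(om in A) (Z om)%:E = \int[P]_(om in A) (X om)%:E]%E.

(* A version of E{X | G}; it exists for every integrable X and is unique up to
   almost sure equality (junk value 0 if there is no version). *)
Definition cond_expect (G : set (set T)) (X : T -> R) : T -> R :=
  xget (cst 0) [set Z | is_cond_expect G X Z].

Definition cond_expect_mx (G : set (set T)) (m n : nat)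
    (X : T -> 'M[R]_(m, n)) : T -> 'M[R]_(m, n) :=
  fun om => \matrix_(i, j) cond_expect G (fun om' => X om' i j) om.

Definition square_integrable (n : nat) (X : T -> 'cV[R]_n) : Prop :=
  ('E_P[fun om => (norm2 (X om) ^+ 2)%R] < +oo)%E.

Definition mutually_independent (I : eqType) (G : I -> set (set T)) : Prop :=
  forall (s : seq I) (E : I -> set T), uniq s ->
    (forall i, i \in s -> G i (E i)) ->
    (P (\big[setI/setT]_(i <- s) E i) = \prod_(i <- s) P (E i))%E.

Definition identically_distributed (I : Type) (m n : nat)
    (X : I -> T -> 'M[R]_(m, n)) : Prop :=
  forall i j D, @mx_borel R m n D -> P (X i @^-1` D) = P (X j @^-1` D).

(* Z is the essential infimum of the family J: the infimum of a family of
   random variables (here, conditional expectations) in the almost sure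
   order. *)
Definition is_ess_infimum (J : set (T -> R)) (Z : T -> R) : Prop :=
  [/\ measurable_fun setT Z,
      forall Y, J Y -> {ae P, forall om, Z om <= Y om} &
      forall Z' : T -> R, measurable_fun setT Z' ->
        (forall Y, J Y -> {ae P, forall om, Z' om <= Y om}) ->
        {ae P, forall om, Z' om <= Z om}].

End Probability.

(* P is a phantom parameter, from which the definitions below recover the
   probability. The noise w 0 does not enter the dynamics. *)
Record lq_system (R : realType) (d : measure_display) (T : measurableType d)
    (P : probability T R) (n m q : nat) := LQSystem {
  A : 'M[R]_n;
  B : 'M[R]_(n, m);
  C : 'M[R]_(q, n);
  Q : 'M[R]_n;
  Qs : 'M[R]_n;
  Qo : 'M[R]_q;
  Ru : 'M[R]_m;
  x0 : T -> 'cV[R]_n;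
  w : nat -> T -> 'cV[R]_n;
  eps : nat -> T -> 'cV[R]_q
}.

Section LQ.
Context {R : realType} {d : measure_display} {T : measurableType d}.
Context {P : probability T R} {n m q : nat} (S : lq_system P n m q).

(* None is the initial state, Some t the pair (w_t, eps_t). *)
Definition source_sigma (i : option nat) : set (set T) :=
  if i is Some t then sigma_of (fun om => col_mx (w S t om) (eps S t om))
  else sigma_of (x0 S).

(* The noise moments are those at time 0; the noise being identically
   distributed, they are the same at all times. *)
Definition wbar : 'cV[R]_n := expect_mx P (w S 0).
Definition epsbar : 'cV[R]_q := expect_mx P (eps S 0).

Definition dw (om : T) : 'cV[R]_n := w S 0 om - wbar.
Definition deps (om : T) : 'cV[R]_q := eps S 0 om - epsbar.
Definition dy (om : T) : 'cV[R]_q := C S *m dw om + deps om.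

Definition covW : 'M[R]_n := expect_mx P (fun om => dw om *m (dw om)^T).
Definition covE : 'M[R]_q := expect_mx P (fun om => deps om *m (deps om)^T).
Definition covH : 'M[R]_(n, q) := expect_mx P (fun om => dw om *m (deps om)^T).

Definition covY : 'M[R]_q :=
  C S *m covW *m (C S)^T + C S *m covH + (C S *m covH)^T + covE.

Definition M3w : 'cV[R]_n :=
  expect_mx P (fun om => dw om *m (dw om)^T *m Qs S *m dw om).
Definition M3y : 'cV[R]_q :=
  expect_mx P (fun om => dy om *m (dy om)^T *m Qo S *m dy om).

Definition Qmu (mus muo : R) : 'M[R]_n :=
  Q S + (4 * mus) *: (Qs S *m covW *m Qs S)
      + (4 * muo) *: ((C S)^T *m Qo S *m covY *m Qo S *m C S).

Definition Mmu (mus muo : R) : 'cV[R]_n :=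
  (4 * mus) *: (Qs S *m M3w)
  + (4 * muo) *: ((C S)^T *m Qo S *m M3y
                  + 2 *: ((C S)^T *m Qo S *m covY *m Qo S *m epsbar)).

Fixpoint state (u : nat -> T -> 'cV[R]_m) (t : nat) (om : T) : 'cV[R]_n :=
  if t is t'.+1 then A S *m state u t' om + B S *m u t' om + w S t om
  else x0 S om.

Definition output (u : nat -> T -> 'cV[R]_m) (t : nat) (om : T) : 'cV[R]_q :=
  C S *m state u t om + eps S t om.

Definition filt (u : nat -> T -> 'cV[R]_m) (t : nat) : set (set T) :=
  <<s [set D | (exists2 s, (s <= t)%N & sigma_of (output u s) D) \/
               (exists2 s, (s < t)%N & sigma_of (u s) D)] >>.

(* Only the inputs at times t < N matter. *)
Definition admissible (N : nat) (u : nat -> T -> 'cV[R]_m) : Prop :=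
  forall t, (t < N)%N ->
    mx_measurable (filt u t) (u t) /\ square_integrable P (u t).

(* xhat u t s is the estimate of the state at time t given the information at
   time s. *)
Definition xhat (u : nat -> T -> 'cV[R]_m) (t s : nat) : T -> 'cV[R]_n :=
  cond_expect_mx P (filt u s) (state u t).

Definition est_err (u : nat -> T -> 'cV[R]_m) (t : nat) (om : T) : 'cV[R]_n :=
  state u t om - xhat u t t om.

(* The one-step prediction error, used at times t >= 1 only. *)
Definition pred_err (u : nat -> T -> 'cV[R]_m) (t : nat) (om : T) : 'cV[R]_n :=
  state u t om - xhat u t t.-1 om.

Definition Sigma (u : nat -> T -> 'cV[R]_m) (t : nat) : T -> 'M[R]_n :=
  cond_expect_mx P (filt u t) (fun om => est_err u t om *m (est_err u t om)^T).

Definition Hpred (u : nat -> T -> 'cV[R]_m) (t : nat) : T -> 'M[R]_n :=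
  cond_expect_mx P (filt u t.-1)
    (fun om => est_err u t om *m (pred_err u t om)^T).

(* One backward step of the recursion for the additive offset, from its value
   pt at time t to its value at time t.-1, with Vt, Tt, St the coefficients at
   time t and v = h + l at time t.-1. The published recursion has
     p_t + tr (Q_mu Sigma_{t|t})
   in place of the terms
     E{p_t + tr (V_t Sigma_{t|t}) | F_{t-1}} + tr (Q_mu Sigma_{t-1|t-1}),
   and the cost-to-go formula is then false: its offset need not be
   F_{t-1}-measurable, and it leaves out tr (Q_mu Sigma_{t-1|t-1}), the
   contribution of the estimation error to the stage cost at time t-1 (e.g.
   A = Q = R = 1, B = C = 0, Qs = Qo = 0, no noise, x_0 uniform on {1, -1} and
   N = 2: the cost-to-go at time 1 is 2 while the published p_1 is 1). The
   terms tr (V_t Sigma_{t|t}) and -2 tr (V_t H_{t|t-1}), together with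
   tr (A^T V_t A Sigma_{t-1|t-1}) + tr (V_t W), expand
   E{(rho_t - e_t)^T V_t (rho_t - e_t) | F_{t-1}}, where
   rho_t - e_t = xhat_{t|t} - xhat_{t|t-1}. *)
Definition offset_step (mus muo : R) (Vt Tt St : 'M[R]_n) (v : 'cV[R]_m)
    (u : nat -> T -> 'cV[R]_m) (t : nat) (pt : T -> R) (om : T) : R :=
  cond_expect P (filt u t.-1)
    (fun om' => pt om' + \tr (Vt *m Sigma u t om')) om
  - qform ((B S)^T *m Vt *m B S + Ru S) v
  + qform (Vt + 2 *: Tt) wbar + dotv wbar (St *m Mmu mus muo)
  + \tr (Qmu mus muo *m Sigma u t.-1 om)
  - 2 * \tr (Vt *m Hpred u t om)
  + \tr ((A S)^T *m Vt *m A S *m Sigma u t.-1 om)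
  + \tr (Vt *m covW).

Definition stage_cost (mus muo : R) (x : 'cV[R]_n) (v : 'cV[R]_m) : R :=
  qform (Qmu mus muo) x + dotv x (Mmu mus muo) + qform (Ru S) v.

Definition terminal_cost (mus muo : R) (x : 'cV[R]_n) : R :=
  qform (Qmu mus muo) x + dotv x (Mmu mus muo).

Definition tail_cost (mus muo : R) (N k : nat) (u : nat -> T -> 'cV[R]_m)
    (om : T) : R :=
  terminal_cost mus muo (state u N om)
  + \sum_(k <= t < N) stage_cost mus muo (state u t om) (u t om).

Definition lagrangian (mus muo : R) (N : nat) (u : nat -> T -> 'cV[R]_m)
  : \bar R := ('E_P[tail_cost mus muo N 0 u])%E.

Definition risk_averse_optimal (mus muo : R) (N : nat)
    (u : nat -> T -> 'cV[R]_m) : Prop :=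
  admissible N u /\
  forall v, admissible N v ->
    (lagrangian mus muo N u <= lagrangian mus muo N v)%E.

(* L is the optimal cost-to-go given the information at time k; the inputs of u
   before time k are kept, so that filt v k = filt u k for every competitor
   v. *)
Definition is_optimal_cost_to_go (mus muo : R) (N k : nat)
    (u : nat -> T -> 'cV[R]_m) (L : T -> R) : Prop :=
  is_ess_infimum P
    [set J | exists v, [/\ admissible N v,
                           forall s, (s < k)%N -> v s = u s &
                           J = cond_expect P (filt v k)
                                 (tail_cost mus muo N k v)]]
    L.

End LQ.

(* Main.v *)
Require Import Defs.
From HB Require Import structures.
From mathcomp Require Import all_boot all_order all_algebra.
From mathcomp Require Import all_classical all_reals all_analysis.
From mathcomp Require Import measurable_realfun ring lra.

Set Implicit Arguments.
Unset Strict Implicit.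
Unset Printing Implicit Defensive.

Import Order.TTheory GRing.Theory Num.Theory.
Import numFieldNormedType.Exports.

Local Open Scope classical_set_scope.
Local Open Scope ring_scope.

(** The theorem is a completion of the square, combined with the separation
    between estimation and control.

    Along every trajectory, the sum of the next value x^T V x + 2 x^T a and of the
    stage cost equals the current value plus the square of u - (K x + h + l), in
    the norm given by B^T V B + R, plus a constant and terms in the centred noise
    ([complete_square], [value_step]); the recursions for V, T, S, K, h and l say
    exactly this. Summing over time expresses the cost-to-go ([tail_costE]).

    The control influences the information only apparently. The system is linear,
    so the state under a control is the uncontrolled state plus a forced response,
    and the controls used so far determine the forced response. Hence all
    admissible controls generate the filtration of the uncontrolled system
    ([filt_obs]) and have, almost surely, the same estimation errors e_t
    ([est_err_no_control]).

    Writing x = xhat + e in the square and taking conditional expectations, the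
    cross terms vanish because e has conditional mean 0, and the noise contributes
    tr (V W) because it is independent of the past. What is left
    ([ce_tail_cost]) is the value of the estimate, a cost that depends only on the
    estimation errors and whose conditional expectation is the offset p
    ([ce_error_cost]), and the sum of the squares of u - (K xhat + h + l). The last
    sum is nonnegative and is 0 for the feedback law, which is admissible; so the
    feedback law attains the optimal cost-to-go ([optimal_cost_to_go]), and it is
    the only minimizer up to null sets ([risk_averse_optimalP]).

    Conditional expectations rest on the Radon-Nikodym theorem ([ce_exists]), on
    taking out known factors ([ceM]) and on a constant conditional expectation in
    the independent case ([ce_independent]). *)

(** * Measurability with respect to a sigma-algebra *)

Lemma closed_sum (R : realType) (T I : Type) (F : (T -> R) -> Prop) (r : seq I)
    (f : I -> T -> R) : F (fun=> 0) ->
  (forall g h, F g -> F h -> F (fun x => g x + h x)) ->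
  (forall i, F (f i)) -> F (fun x => \sum_(i <- r) f i x).
Proof.
move=> F0 FD Ff; elim: r => [|i r IH].
  by under eq_fun do rewrite big_nil.
by under eq_fun do rewrite big_cons; exact: FD.
Qed.

Definition sub_sigma d (T : measurableType d) (G : set (set T)) : Prop :=
  sigma_algebra setT G /\ G `<=` measurable.

(** Measurability for a sigma-algebra that is a variable of the statement: for
    [measurable_fun] it is determined by the type of the domain. *)
Definition mfun_wrt (R : realType) (T : Type) (G : set (set T)) (X : T -> R) :
  Prop := preimage_set_system setT X measurable `<=` G.

Section measurable_wrt.
Context {R : realType} {T : pointedType}.
Implicit Types (G : set (set T)) (X Y : T -> R).

Lemma mfun_wrtP G X : sigma_algebra setT G ->
  mfun_wrt G X <->
  measurable_fun setT (X : g_sigma_algebraType G -> R).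
Proof.
move=> sG; split=> [h _ B mB|h _ [B mB <-]].
  rewrite measurable_g_measurableTypeE//; apply: h; by exists B.
by rewrite -[G](measurable_g_measurableTypeE sG); exact: h.
Qed.

Lemma mfun_wrt_sub G H X : G `<=` H -> mfun_wrt G X -> mfun_wrt H X.
Proof. by move=> GH h A /h /GH. Qed.

Lemma mfun_wrt_cst G c : sigma_algebra setT G -> mfun_wrt G (fun=> c : R).
Proof. by move=> sG; apply/mfun_wrtP => //; exact: measurable_cst. Qed.

Lemma mfun_wrtD G X Y : sigma_algebra setT G ->
  mfun_wrt G X -> mfun_wrt G Y -> mfun_wrt G (fun x => X x + Y x).
Proof.
move=> sG /(mfun_wrtP _ sG) mX /(mfun_wrtP _ sG) mY.
by apply/mfun_wrtP => //; exact: measurable_funD.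
Qed.

Lemma mfun_wrtM G X Y : sigma_algebra setT G ->
  mfun_wrt G X -> mfun_wrt G Y -> mfun_wrt G (fun x => X x * Y x).
Proof.
move=> sG /(mfun_wrtP _ sG) mX /(mfun_wrtP _ sG) mY.
by apply/mfun_wrtP => //; exact: measurable_funM.
Qed.

Lemma mfun_wrt_sum G (I : Type) (r : seq I) (F : I -> T -> R) :
  sigma_algebra setT G ->
  (forall i, mfun_wrt G (F i)) -> mfun_wrt G (fun x => \sum_(i <- r) F i x).
Proof.
move=> sG; apply: closed_sum; first exact: mfun_wrt_cst.
by move=> f g; exact: mfun_wrtD.
Qed.

End measurable_wrt.

Lemma mfun_wrt_measurable (R : realType) d (T : measurableType d)
    (G : set (set T)) (X : T -> R) : G `<=` measurable ->
  mfun_wrt G X -> measurable_fun setT X.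
Proof. by move=> GM h _ B mB; apply: GM; apply: h; exists B. Qed.

(** * Existence of conditional expectations *)

(** The Radon-Nikodym theorem speaks of the measurable sets of a type, so the
    sub-sigma-algebra G becomes a type of its own: [restr_prob] is the image of
    P under the identity, from T to T equipped with G. *)
Section restriction.
Context {R : realType} {d : measure_display} {T : measurableType d}.
Variables (P : probability T R) (G : set (set T)) (GM : sub_sigma G).

Let idG : T -> g_sigma_algebraType G := id.

Let midG : measurable_fun setT idG.
Proof.
move=> _ B; rewrite measurable_g_measurableTypeE; last exact: GM.1.
by move=> /GM.2 mB; rewrite setTI.
Qed.

Let idGm : {mfun T >-> g_sigma_algebraType G} :=
  MeasurableFun.Pack (MeasurableFun.Class (isMeasurableFun.Build _ _ _ _ _ midG)).

Definition restr_prob : probability (g_sigma_algebraType G) R :=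
  distribution P idGm.

Lemma restr_integral (f : T -> \bar R) A :
  measurable_fun setT (f : g_sigma_algebraType G -> \bar R) ->
  P.-integrable setT f -> G A ->
  (\int[restr_prob]_(x in (A : set (g_sigma_algebraType G))) f x =
   \int[P]_(x in A) f x)%E.
Proof.
move=> mf fi GA.
have mA : measurable (A : set (g_sigma_algebraType G)).
  by rewrite measurable_g_measurableTypeE//; exact: GM.1.
apply: (@integral_pushforward _ _ T (g_sigma_algebraType G) R idG midG P
  (A : set (g_sigma_algebraType G)) f mf _ mA).
by apply: (integrableS _ _ _ fi) => //; exact: GM.2.
Qed.

Lemma restr_integrableV (f : T -> \bar R) :
  restr_prob.-integrable setT f -> P.-integrable setT f.
Proof.
move=> /integrableP[mf fi]; apply/integrableP; split.
  move=> _ B mB; apply: GM.2; rewrite -[G](measurable_g_measurableTypeE GM.1).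
  exact: mf.
apply: le_lt_trans fi.
rewrite (@ge0_integral_pushforward _ _ T (g_sigma_algebraType G) R idG midG P
  setT (abse \o (f : g_sigma_algebraType G -> \bar R)))//.
  exact: measurableT_comp.
by move=> y _; exact: abse_ge0.
Qed.

End restriction.

Section cond_expect_theory.
Context {R : realType} {d : measure_display} {T : measurableType d}.
Variable P : probability T R.
Implicit Types (G H : set (set T)) (X Y Z : T -> R).

Definition integrable1 X : Prop := P.-integrable setT (EFin \o X).

(** Z is a version of the conditional expectation of X given G. All
    computations are made with this relation, where they hold everywhere;
    almost sure equalities come in only through the uniqueness of versions. The
    relation includes the integrability of X, which every rule would otherwise
    have to assume. *)
Definition ce G X Z : Prop := integrable1 X /\ is_cond_expect P G X Z.

Lemma integrable1D X Y : integrable1 X -> integrable1 Y ->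
  integrable1 (fun x => X x + Y x).
Proof. by move=> iX iY; exact: (integrableD measurableT iX iY). Qed.

Lemma integrable1Z c X : integrable1 X -> integrable1 (fun x => c * X x).
Proof. by move=> iX; exact: (integrableZl measurableT c iX). Qed.

Lemma integrable1_cst c : integrable1 (fun=> c).
Proof. exact: finite_measure_integrable_cst. Qed.

Lemma integrable1_measurable X : integrable1 X -> measurable_fun setT X.
Proof. by move=> /measurable_int/measurable_EFinP. Qed.

Lemma integrable1S X A : measurable A -> integrable1 X ->
  P.-integrable A (EFin \o X).
Proof. by move=> mA iX; exact: (integrableS measurableT mA _ iX). Qed.

Lemma integrable1_sum (I : Type) (r : seq I) (F : I -> T -> R) :
  (forall i, integrable1 (F i)) -> integrable1 (fun x => \sum_(i <- r) F i x).
Proof.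
by apply: closed_sum; [exact: integrable1_cst|move=> f g; exact: integrable1D].
Qed.

Lemma integrable1_le X Y : measurable_fun setT X -> integrable1 Y ->
  (forall x, `|X x| <= Y x) -> integrable1 X.
Proof.
move=> mX iY XY; apply: (le_integrable measurableT _ _ iY).
  exact/measurable_EFinP.
by move=> x _ /=; rewrite lee_fin (le_trans (XY x))// ler_norm.
Qed.

Lemma integral_eq_of_ae X Y A : measurable A -> integrable1 X ->
  measurable_fun setT Y -> {ae P, forall x, X x = Y x} ->
  (\int[P]_(x in A) (X x)%:E = \int[P]_(x in A) (Y x)%:E)%E.
Proof.
move=> mA iX mY XY; apply: ae_eq_integral => //.
- by apply/measurable_EFinP/measurable_funTS/integrable1_measurable.
- exact/measurable_EFinP/measurable_funTS.
- by apply: filterS XY => x -> _.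
Qed.

Lemma integrable1_ae X Y : integrable1 X -> measurable_fun setT Y ->
  {ae P, forall x, X x = Y x} -> integrable1 Y.
Proof.
move=> iX mY XY.
apply/integrableP; split; first exact/measurable_EFinP.
have /integrableP[_] := iX; congr (_ < _)%E; apply: ae_eq_integral => //.
- by apply/measurableT_comp => //; apply/measurable_EFinP/integrable1_measurable.
- by apply/measurableT_comp => //; apply/measurable_EFinP.
- by apply: filterS XY => x /= -> _.
Qed.

Section restr_charge.
Variables (G : set (set T)) (sG : sub_sigma G) (X : T -> R).
Hypothesis iX : integrable1 X.

Definition restr_charge (A : set (g_sigma_algebraType G)) : \bar R :=
  (\int[P]_(x in (A : set T)) (X x)%:E)%E.

Let GT (A : set (g_sigma_algebraType G)) :
  measurable A -> measurable (A : set T).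
Proof. by rewrite measurable_g_measurableTypeE; [move/sG.2|exact: sG.1]. Qed.

Let nu0 : restr_charge set0 = 0%E. Proof. exact: integral_set0. Qed.

Let nufin A : measurable A -> restr_charge A \is a fin_num.
Proof. by move=> /GT mA; apply: integrable_fin_num => //; exact: integrable1S. Qed.

Let nuadd : semi_sigma_additive restr_charge.
Proof.
move=> F mF tF mUF.
exact: (@charge_semi_sigma_additive _ _ _ (induced_charge iX) F
  (fun i => GT (mF i)) tF (GT mUF)).
Qed.

HB.instance Definition _ := isCharge.Build _ _ _ restr_charge nu0 nufin nuadd.

Lemma restr_charge_dominated : restr_charge `<< restr_prob P sG.
Proof.
apply/null_content_dominatesP => A mA PA0.
apply: null_set_integral => //; first exact: GT.
by apply/measurable_EFinP/measurable_funTS/integrable1_measurable.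
Qed.

(** The derivative with respect to P on G of the charge A |-> E[X 1_A]. *)
Lemma ce_exists : exists Z, ce G X Z.
Proof.
pose PG := restr_prob P sG.
pose f := Radon_Nikodym restr_charge PG.
have dom := restr_charge_dominated.
have fi : PG.-integrable setT f by exact: Radon_Nikodym_integrable.
have ffin x : f x \is a fin_num by exact: Radon_Nikodym_fin_num.
have fE : f = EFin \o (fine \o f) by apply/funext => x /=; rewrite fineK.
have mf : measurable_fun setT f := measurable_int _ fi.
exists (fine \o f); split => //; split.
- apply/(mfun_wrtP _ sG.1); apply/measurable_EFinP.
  by rewrite -fE.
- by rewrite -fE; exact: (restr_integrableV fi).
- move=> A GA; rewrite -[RHS]/(restr_charge A).
  have mA : measurable (A : set (g_sigma_algebraType G)).
    by rewrite measurable_g_measurableTypeE//; exact: sG.1.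
  rewrite (Radon_Nikodym_integral dom mA).
  rewrite (@restr_integral R d T P G sG)//; last exact: (restr_integrableV fi).
  by apply: eq_integral => x _; rewrite -/f -[in RHS](fineK (ffin x)).
Qed.

End restr_charge.

End cond_expect_theory.

(** * Calculus of conditional expectations *)

Section ce_calculus.
Context {R : realType} {d : measure_display} {T : measurableType d}.
Variable P : probability T R.
Implicit Types (G H : set (set T)) (X Y Z W : T -> R).

Local Notation ce := (ce P).
Local Notation integrable1 := (integrable1 P).

Lemma ce_integrable G X Z : ce G X Z -> integrable1 Z.
Proof. by case=> _ []. Qed.

Lemma ce_mfun G X Z : ce G X Z -> mfun_wrt G Z.
Proof. by case=> _ []. Qed.

Lemma ce_cond_expect G X : sub_sigma G -> integrable1 X ->
  ce G X (cond_expect P G X).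
Proof.
move=> sG iX; split=> //; rewrite /cond_expect; case: xgetP => [Z _ //|/= h].
by have [Z [_ hZ]] := ce_exists sG iX; case: (h Z).
Qed.

Lemma ce_self G X : mfun_wrt G X -> integrable1 X -> ce G X X.
Proof. by []. Qed.

Lemma ce_cst G c : sigma_algebra setT G -> ce G (fun=> c) (fun=> c).
Proof. by move=> sG; apply: ce_self; [exact: mfun_wrt_cst|exact: integrable1_cst]. Qed.

Lemma ceD G X Y Z W : sub_sigma G -> ce G X Z -> ce G Y W ->
  ce G (fun x => X x + Y x) (fun x => Z x + W x).
Proof.
move=> sG [iX [mZ iZ XZ]] [iY [mW iW YW]]; split; first exact: integrable1D.
split; [exact: mfun_wrtD sG.1 _ _|exact: integrable1D|move=> A GA].
have mA := sG.2 A GA.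
by rewrite !integralD_EFin ?XZ ?YW//; exact: integrable1S.
Qed.

Lemma ceZ G c X Z : sub_sigma G -> ce G X Z ->
  ce G (fun x => c * X x) (fun x => c * Z x).
Proof.
move=> sG [iX [mZ iZ XZ]]; split; first exact: integrable1Z.
split; [|exact: integrable1Z|move=> A GA].
  by apply: mfun_wrtM => //; [exact: sG.1|apply: mfun_wrt_cst; exact: sG.1].
have mA := sG.2 A GA.
under eq_integral do rewrite EFinM.
under [RHS]eq_integral do rewrite EFinM.
by rewrite !integralZl ?XZ//; exact: integrable1S.
Qed.

Lemma ceB G X Y Z W : sub_sigma G -> ce G X Z -> ce G Y W ->
  ce G (fun x => X x - Y x) (fun x => Z x - W x).
Proof.
move=> sG cX cY; have := ceD sG cX (ceZ (-1) sG cY).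
by congr ce; apply/funext => x; rewrite mulN1r.
Qed.

Lemma ce_sum_in G (I : eqType) (r : seq I) (F E : I -> T -> R) : sub_sigma G ->
  (forall i, i \in r -> ce G (F i) (E i)) ->
  ce G (fun x => \sum_(i <- r) F i x) (fun x => \sum_(i <- r) E i x).
Proof.
move=> sG; elim: r => [|i r IH] hF.
  have := ce_cst 0 sG.1; congr ce; apply/funext => x; by rewrite big_nil.
have cr : ce G (fun x => \sum_(j <- r) F j x) (fun x => \sum_(j <- r) E j x).
  by apply: IH => j jr; apply: hF; rewrite inE jr orbT.
have := ceD sG (hF i (mem_head _ _)) cr.
by congr ce; apply/funext => x; rewrite big_cons.
Qed.

Lemma ce_sum G (I : eqType) (r : seq I) (F E : I -> T -> R) : sub_sigma G ->
  (forall i, ce G (F i) (E i)) ->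
  ce G (fun x => \sum_(i <- r) F i x) (fun x => \sum_(i <- r) E i x).
Proof. by move=> sG h; apply: ce_sum_in. Qed.

Lemma ce_aeL G X Y Z : sub_sigma G -> measurable_fun setT Y ->
  {ae P, forall x, X x = Y x} -> ce G X Z -> ce G Y Z.
Proof.
move=> sG mY XY [iX [mZ iZ XZ]].
split; first exact: (integrable1_ae iX mY XY).
split=> // A GA; rewrite XZ//; apply: integral_eq_of_ae => //.
exact: sG.2.
Qed.

Lemma ce_tower G H X Z W : H `<=` G -> ce G X Z -> ce H Z W -> ce H X W.
Proof.
move=> HG [iX [mZ iZ XZ]] [_ [mW iW ZW]]; split=> //; split=> // A HA.
by rewrite ZW// XZ//; exact: HG.
Qed.

(** The set where Z is negative belongs to G, so the integral of Z over it is
    nonnegative, which makes it a null set. *)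
Lemma ae_ge0_of_integral G Z : sub_sigma G -> mfun_wrt G Z -> integrable1 Z ->
  (forall A, G A -> (0 <= \int[P]_(x in A) (Z x)%:E)%E) ->
  {ae P, forall x, 0 <= Z x}.
Proof.
move=> sG mZ iZ hZ; pose A := Z @^-1` `]-oo, 0[.
have GA : G A by apply: mZ; exists `]-oo, 0[%classic; rewrite ?setTI.
have mA := sG.2 _ GA.
have mZA : measurable_fun A (EFin \o Z).
  by apply/measurable_EFinP/measurable_funTS; exact: (integrable1_measurable iZ).
have AN x : A x -> Z x < 0 by rewrite /A /= in_itv.
have : (\int[P]_(x in A) `|(EFin \o Z) x| = 0)%E.
  under eq_integral.
    move=> x; rewrite inE => /AN Ax.
    rewrite /= ltr0_norm// -[(- Z x)]mulN1r EFinM; over.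
  rewrite integralZl//; last exact: integrable1S.
  apply/eqP; rewrite eq_le; apply/andP; split.
    by rewrite EFinN mulN1e oppe_le0; exact: hZ.
  rewrite -integralZl//; last exact: integrable1S.
  by apply: integral_ge0 => x /AN Zx; rewrite -EFinM mulN1r lee_fin oppr_ge0 ltW.
move=> /(ae_eq_integral_abs P mA mZA); apply: filterS => x Ax0.
rewrite leNgt; apply/negP => Zx.
have Ax : A x by rewrite /A /= in_itv.
by have [Zx0] := Ax0 Ax; rewrite Zx0 ltxx in Zx.
Qed.

Lemma ce_le G X Y Z W : sub_sigma G -> ce G X Z -> ce G Y W ->
  {ae P, forall x, X x <= Y x} -> {ae P, forall x, Z x <= W x}.
Proof.
move=> sG cX cY XY; have [iD [mD iD' hD]] := ceB sG cY cX.
have : {ae P, forall x, 0 <= W x - Z x}.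
  apply: (ae_ge0_of_integral sG mD iD') => A GA; rewrite hD//.
  have mA := sG.2 _ GA.
  have <- : (\int[P]_(x in A) `|Y x - X x|%:E = \int[P]_(x in A) (Y x - X x)%:E)%E.
    apply: integral_eq_of_ae => //.
    - exact: (integrable_norm iD).
    - exact: integrable1_measurable iD.
    - by apply: filterS XY => x; rewrite -subr_ge0 => /ger0_norm.
  by apply: integral_ge0 => x _; rewrite lee_fin.
by apply: filterS => x; rewrite subr_ge0.
Qed.

Lemma ce_ae_uniq G X Y Z W : sub_sigma G -> ce G X Z -> ce G Y W ->
  {ae P, forall x, X x = Y x} -> {ae P, forall x, Z x = W x}.
Proof.
move=> sG cX cY XY.
have h1 : {ae P, forall x, Z x <= W x}.
  by apply: (ce_le sG cX cY); apply: filterS XY => x ->.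
have h2 : {ae P, forall x, W x <= Z x}.
  by apply: (ce_le sG cY cX); apply: filterS XY => x ->.
by apply: filterS2 h1 h2 => x ZW WZ; apply/eqP; rewrite eq_le ZW WZ.
Qed.

Lemma ce_integral G X Z : sub_sigma G -> ce G X Z ->
  (\int[P]_x (X x)%:E = \int[P]_x (Z x)%:E)%E.
Proof.
move=> [[G0 GC _] _] [_ [_ _]] -> //.
by rewrite -(setD0 setT); exact: GC.
Qed.

Import HBSimple HBNNSimple.

(** The next three lemmas show that a D whose integrals over the sets of G
    vanish is orthogonal to every G-measurable Y: first for simple functions,
    which are combinations of indicators of sets of G, then for nonnegative Y
    by dominated convergence, then by splitting Y into its two parts. *)
Lemma integral_simple_mul_eq0 G (D : T -> R)
    (f : {nnsfun (g_sigma_algebraType G) >-> R}) : sub_sigma G ->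
  integrable1 D -> (forall A, G A -> \int[P]_(x in A) (D x)%:E = 0)%E ->
  (\int[P]_x (f x * D x)%:E = 0)%E.
Proof.
move=> sG iD D0.
have Gf y : G (f @^-1` [set y]).
  have : measurable (f @^-1` [set y]).
    by rewrite -[X in measurable X]setTI; exact: measurable_funP.
  by rewrite measurable_g_measurableTypeE//; exact: sG.1.
have i1 y : integrable1 (fun x : T => \1_(f @^-1` [set y]) x * D x).
  apply: (integrable1_le _ (integrable_norm iD)).
    apply: measurable_funM; last exact: integrable1_measurable iD.
    by apply: measurable_indic; exact: sG.2.
  move=> x; rewrite normrM indicE normr_nat.
  by case: (_ \in _); rewrite /= ?mul1r ?mul0r.
transitivity (\int[P]_x (\sum_(y <- finmap.enum_fset (fset_set (range f)))
    (y * (\1_(f @^-1` [set y]) x * D x))%:E))%E.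
  apply: eq_integral => x _; rewrite sumEFin; congr EFin.
  rewrite fimfunE fsbig_finite//= mulr_suml; apply: eq_bigr => y _.
  by rewrite mulrA.
rewrite integral_sum//; last by move=> y; exact: (integrable1Z y (i1 y)).
rewrite big1// => y _.
under eq_integral do rewrite EFinM.
rewrite integralZl//; last exact: i1.
rewrite (_ : integral _ _ _ = 0%E) ?mule0//.
rewrite -[RHS](D0 _ (Gf y)) [RHS]integral_mkcond.
apply: eq_integral => x _; rewrite epatch_indic/=.
by rewrite -EFinM mulrC.
Qed.

Lemma ge0_integral_mul_eq0 G (D Y : T -> R) : sub_sigma G ->
  integrable1 D -> (forall A, G A -> \int[P]_(x in A) (D x)%:E = 0)%E ->
  mfun_wrt G Y -> (forall x, 0 <= Y x) -> integrable1 (fun x => Y x * D x) ->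
  (\int[P]_x (Y x * D x)%:E = 0)%E.
Proof.
move=> sG iD D0 mY Y0 iYD.
have mY' : measurable_fun setT (EFin \o Y : g_sigma_algebraType G -> \bar R).
  by apply/measurable_EFinP; apply/(mfun_wrtP _ sG.1).
pose f := nnsfun_approx measurableT mY'.
have mf n : mfun_wrt G (f n) by apply/(mfun_wrtP _ sG.1).
have f0 n x : 0 <= f n x by [].
have fY n x : f n x <= Y x.
  rewrite -lee_fin /f nnsfun_approxE.
  by apply: le_approx => // y _; rewrite lee_fin.
have [//|//||||_ _] := @dominated_convergence _ T R P setT measurableT
  (fun n x => (f n x * D x)%:E) (fun x => (Y x * D x)%:E)
  (fun x => `|Y x * D x|%:E).
- move=> n; apply/measurable_EFinP; apply: measurable_funM.
    exact: (mfun_wrt_measurable sG.2 (mf n)).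
  exact: (integrable1_measurable iD).
- by apply/measurable_EFinP; exact: (integrable1_measurable iYD).
- apply: aeW => x _; rewrite EFinM.
  under eq_fun do rewrite EFinM.
  apply: cvgeZr => //; apply: (cvg_nnsfun_approx measurableT mY') => //.
  by move=> y _; rewrite lee_fin.
- exact: (integrable_norm iYD).
- apply: aeW => x n _; rewrite lee_fin !normrM ler_wpM2r//.
  by rewrite !ger0_norm.
under eq_fun do rewrite (integral_simple_mul_eq0 _ sG iD D0).
by move=> /cvg_unique; apply => //; exact: cvg_cst.
Qed.

Lemma integral_mul_eq0 G (D Y : T -> R) : sub_sigma G ->
  integrable1 D -> (forall A, G A -> \int[P]_(x in A) (D x)%:E = 0)%E ->
  mfun_wrt G Y -> integrable1 (fun x => Y x * D x) ->
  (\int[P]_x (Y x * D x)%:E = 0)%E.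
Proof.
move=> sG iD D0 mY iYD.
have part (Z : T -> R) : mfun_wrt G Z -> (forall x, 0 <= Z x) ->
    (forall x, `|Z x| <= `|Y x|) -> integrable1 (fun x => Z x * D x) /\
    (\int[P]_x (Z x * D x)%:E = 0)%E.
  move=> mZ Z0 ZY.
  have iZD : integrable1 (fun x => Z x * D x).
    apply: (integrable1_le _ (integrable_norm iYD)).
      apply: measurable_funM; last exact: integrable1_measurable iD.
      exact: (mfun_wrt_measurable sG.2 mZ).
    by move=> x /=; rewrite !normrM ler_wpM2r.
  by split=> //; exact: (ge0_integral_mul_eq0 sG iD D0).
have [|x|x|ip p0] := part (fun x => Num.max (Y x) 0).
- by apply/(mfun_wrtP _ sG.1); apply: measurable_maxr => //; apply/(mfun_wrtP _ sG.1).
- by rewrite le_max lexx orbT.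
- by case: (leP (Y x) 0) => _ //; rewrite normr0.
have [|x|x|im m0] := part (fun x => Num.max (-1 * Y x) 0).
- apply/(mfun_wrtP _ sG.1); apply: measurable_maxr => //; apply/(mfun_wrtP _ sG.1).
  by apply: mfun_wrtM => //; [exact: sG.1|apply: mfun_wrt_cst; exact: sG.1].
- by rewrite le_max lexx orbT.
- by case: (leP (-1 * Y x) 0) => _; rewrite ?normr0// mulN1r normrN.
transitivity (\int[P]_x ((Num.max (Y x) 0 * D x)%:E - (Num.max (-1 * Y x) 0 * D x)%:E))%E.
  apply: eq_integral => x _; rewrite -EFinB -mulrBl mulN1r; congr (_ * _)%:E.
  case: (leP (Y x) 0) => Y0.
    by rewrite sub0r max_l ?opprK// oppr_ge0.
  by rewrite max_r ?subr0// oppr_le0 ltW.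
by rewrite integralB_EFin// p0 m0 sube0.
Qed.

(** Taking out what is known: X - Z is orthogonal to 1_A Y for A in G. *)
Lemma ceM G X Y Z : sub_sigma G -> ce G X Z -> mfun_wrt G Y ->
  integrable1 (fun x => Y x * X x) -> integrable1 (fun x => Y x * Z x) ->
  ce G (fun x => Y x * X x) (fun x => Y x * Z x).
Proof.
move=> sG cX mY iYX iYZ; split=> //; split=> //.
  by apply: mfun_wrtM => //; [exact: sG.1|exact: ce_mfun cX].
move=> A GA; have mA := sG.2 _ GA.
have iX : integrable1 X by case: cX.
have iZ := ce_integrable cX.
have mI : mfun_wrt G (fun x => \1_A x * Y x).
  apply: mfun_wrtM => //; first exact: sG.1.
  apply/(mfun_wrtP _ sG.1).
  apply: (@measurable_indic _ (g_sigma_algebraType G)).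
  by rewrite measurable_g_measurableTypeE//; exact: sG.1.
have iI W : integrable1 (fun x => Y x * W x) ->
    integrable1 (fun x => \1_A x * Y x * W x) /\
    (\int[P]_x (\1_A x * Y x * W x)%:E = \int[P]_(x in A) (Y x * W x)%:E)%E.
  move=> iW; split.
    apply: (integrable1_le _ (integrable_norm iW)).
      under eq_fun do rewrite -mulrA.
      apply: measurable_funM; first exact: measurable_indic.
      exact: integrable1_measurable iW.
    move=> x; rewrite -mulrA normrM indicE normr_nat.
    by case: (_ \in _); rewrite /= ?mul1r ?mul0r.
  rewrite [RHS]integral_mkcond; apply: eq_integral => x _.
  by rewrite epatch_indic/= -mulrA mulrC EFinM.
have [iIX eX] := iI X iYX; have [iIZ eZ] := iI Z iYZ.
rewrite -eX -eZ.
have iD : integrable1 (fun x => X x - Z x).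
  by have [] := integrableB measurableT iX iZ.
have D0 B : G B -> (\int[P]_(x in B) (X x - Z x)%:E = 0)%E.
  move=> GB; have mB := sG.2 _ GB.
  rewrite integralB_EFin//; [|exact: integrable1S..].
  have [_ [_ _ ->//]] := cX; rewrite subee//.
  by apply: integrable_fin_num => //; exact: integrable1S.
have fX := integrable_fin_num measurableT iIX.
have fZ := integrable_fin_num measurableT iIZ.
have := integral_mul_eq0 sG iD D0 mI.
under [X in integrable1 X]eq_fun do rewrite mulrBr.
under eq_integral do rewrite mulrBr.
rewrite integralB_EFin// => /(_ (integrableB measurableT iIX iIZ))/eqP.
by rewrite sube_eq ?fin_num_adde_defl// add0e => /eqP.
Qed.

End ce_calculus.

(** * Square-integrable variables *)

Section square_integrability.
Context {R : realType} {d : measure_display} {T : measurableType d}.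
Variable P : probability T R.
Implicit Types (G H : set (set T)) (X Y Z W : T -> R).

Local Notation ce := (ce P).
Local Notation integrable1 := (integrable1 P).

Definition L2 X : Prop :=
  measurable_fun setT X /\ integrable1 (fun x => X x ^+ 2).

Lemma L2M X Y : L2 X -> L2 Y -> integrable1 (fun x => X x * Y x).
Proof.
move=> [mX iX] [mY iY]; apply: (integrable1_le _ (integrable1D iX iY)).
  exact: measurable_funM.
(* 2 |xy| <= x^2 + y^2 *)
by move=> x; rewrite ler_norml; apply/andP; split; nra.
Qed.

Lemma L2_cst c : L2 (fun=> c).
Proof. by split; [exact: measurable_cst|exact: integrable1_cst]. Qed.

Lemma L2_integrable X : L2 X -> integrable1 X.
Proof.
by move=> /L2M/(_ (L2_cst 1)); under eq_fun do rewrite mulr1.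
Qed.

Lemma L2D X Y : L2 X -> L2 Y -> L2 (fun x => X x + Y x).
Proof.
move=> hX hY; split; first by case: hX hY => [? _] [? _]; exact: measurable_funD.
have := integrable1D (integrable1D hX.2 hY.2) (integrable1Z 2 (L2M hX hY)).
by congr integrable1; apply/funext => x; ring.
Qed.

Lemma L2Z c X : L2 X -> L2 (fun x => c * X x).
Proof.
move=> [mX iX]; split; first by apply: measurable_funM => //.
by under eq_fun do rewrite exprMn; exact: integrable1Z.
Qed.

Lemma L2_sum (I : Type) (r : seq I) (F : I -> T -> R) :
  (forall i, L2 (F i)) -> L2 (fun x => \sum_(i <- r) F i x).
Proof. by apply: closed_sum; [exact: L2_cst|move=> f g; exact: L2D]. Qed.

(** The quadratic is negative between z and z + sqrt (z^2 - u), an interval that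
    would contain a rational. Only rationals are available, because the
    inequality will be known almost surely for each q and a countable family of
    exceptional sets is needed. *)
Lemma le_of_rat_quadratic (z u : R) :
  (forall q : rat, 0 <= u - 2 * ratr q * z + ratr q ^+ 2) -> z ^+ 2 <= u.
Proof.
move=> h; rewrite leNgt; apply/negP => uz.
pose e := Num.sqrt (z ^+ 2 - u).
have e0 : 0 < e by rewrite sqrtr_gt0 subr_gt0.
have e2 : e ^+ 2 = z ^+ 2 - u by rewrite sqr_sqrtr// subr_ge0 ltW.
have ze : z < z + e by rewrite ltrDl.
have [q] := rat_in_itvoo ze.
rewrite in_itv/= => /andP[q1 q2]; have := h q.
by apply/negP; rewrite -ltNge; nra.
Qed.

(** Conditional Jensen inequality for the square: E[(X - q)^2 | G] >= 0 for all
    rational q. *)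
Lemma ce_sqr_le G X Z U : sub_sigma G -> L2 X -> ce G X Z ->
  ce G (fun x => X x ^+ 2) U -> {ae P, forall x, Z x ^+ 2 <= U x}.
Proof.
move=> sG hX cX cU.
have hq (q : R) : {ae P, forall x, 0 <= U x - 2 * q * Z x + q ^+ 2}.
  have c1 := ceD sG (ceB sG cU (ceZ (2 * q) sG cX)) (ce_cst P (q ^+ 2) sG.1).
  apply: (ce_le sG (ce_cst P 0 sG.1) c1); apply: aeW => x.
  by rewrite (_ : _ + _ = (X x - q) ^+ 2) ?sqr_ge0//; ring.
have := ae_foralln (fun n => hq (ratr (odflt 0 (unpickle n : option rat)))).
apply: filterS => x hx; apply: le_of_rat_quadratic => q.
by have := hx (pickle q); rewrite pickleK.
Qed.

Lemma ce_L2 G X Z : sub_sigma G -> L2 X -> ce G X Z -> L2 Z.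
Proof.
move=> sG hX cX; have [U cU] := ce_exists sG hX.2.
have mZ := mfun_wrt_measurable sG.2 (ce_mfun cX).
have mU := mfun_wrt_measurable sG.2 (ce_mfun cU).
split=> //.
(* the square of Z is below U only almost surely, below the maximum everywhere *)
have iM : integrable1 (fun x => Num.max (U x) (Z x ^+ 2)).
  apply: (integrable1_ae (ce_integrable cU)).
    by apply: measurable_maxr => //; exact: measurable_funX.
  by apply: filterS (ce_sqr_le sG hX cX cU) => x /max_l.
apply: (integrable1_le _ iM); first exact: measurable_funX.
by move=> x; rewrite ger0_norm ?sqr_ge0// le_max lexx orbT.
Qed.

Lemma ceM_L2 G X Y Z : sub_sigma G -> L2 X -> L2 Y -> mfun_wrt G Y ->
  ce G X Z -> ce G (fun x => Y x * X x) (fun x => Y x * Z x).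
Proof.
move=> sG hX hY mY cX; apply: ceM => //; first exact: L2M.
by apply: L2M => //; exact: (ce_L2 sG hX cX).
Qed.

Definition independent_of G Y : Prop := forall A D, G A -> measurable D ->
  (P (A `&` Y @^-1` D) = P A * P (Y @^-1` D))%E.

(** The roles are exchanged: given the sigma-algebra of Y, the indicator of A has
    the constant version P(A); taking Y out gives E[Y 1_A] = E[Y] P(A). *)
Lemma ce_independent G Y : sub_sigma G -> integrable1 Y ->
  independent_of G Y -> ce G Y (fun=> fine (\int[P]_x (Y x)%:E)).
Proof.
move=> sG iY indY; have mY := integrable1_measurable iY.
split=> //; split; [exact: mfun_wrt_cst sG.1|exact: integrable1_cst|].
move=> A GA; have mA := sG.2 _ GA.
pose sY := preimage_set_system setT Y measurable.
have ssY : sub_sigma sY.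
  split; first exact: sigma_algebra_preimage (sigma_algebra_measurable _).
  by move=> _ [B mB <-]; exact: mY.
have cA : ce sY (\1_A : T -> R) (fun=> fine (P A)).
  split; first by apply: integrable_indic => //; rewrite ltey_eq fin_num_measure.
  split; [exact: mfun_wrt_cst ssY.1|exact: integrable1_cst|].
  move=> _ [B mB <-]; have mYB : measurable (Y @^-1` B).
    by rewrite -[X in measurable X]setTI; exact: mY.
  rewrite setTI integral_cst// integral_indic// fineK ?fin_num_measure//.
  exact: (esym (indY _ _ GA mB)).
have iIY : integrable1 (fun x => Y x * \1_A x).
  apply: (integrable1_le _ (integrable_norm iY)).
    by apply: measurable_funM => //; exact: measurable_indic.
  move=> x; rewrite normrM indicE normr_nat.
  by case: (_ \in _); rewrite /= ?mulr1 ?mulr0.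
have iPY : integrable1 (fun x => Y x * fine (P A)).
  by under eq_fun do rewrite mulrC; exact: integrable1Z.
have iE := ce_integral ssY (ceM ssY cA (fun _ h => h) iIY iPY).
rewrite [RHS]integral_mkcond.
transitivity (\int[P]_x (Y x * \1_A x)%:E)%E; last first.
  by apply: eq_integral => x _; rewrite epatch_indic/= EFinM.
rewrite iE integral_cst//.
under [RHS]eq_integral do rewrite mulrC EFinM.
rewrite integralZl// muleC !fineK ?fin_num_measure//.
exact: (integrable_fin_num measurableT iY).
Qed.

End square_integrability.

(** * Random vectors and matrices *)

Section entrywise.
Context {R : realType} {T : Type}.
Variable F : (T -> R) -> Prop.

(** F stands for one of the classes of random variables above: measurable,
    integrable, square-integrable. *)
Definition entrywise (m n : nat) (X : T -> 'M[R]_(m, n)) : Prop :=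
  forall i j, F (fun om => X om i j).

Hypothesis F_cst : forall c, F (fun=> c).
Hypothesis F_add : forall f g, F f -> F g -> F (fun x => f x + g x).
Hypothesis F_scale : forall c f, F f -> F (fun x => c * f x).

Lemma entrywise_cst m n (M : 'M[R]_(m, n)) : entrywise (fun=> M).
Proof. by move=> i j; exact: F_cst. Qed.

Lemma entrywise_add m n (X Y : T -> 'M[R]_(m, n)) :
  entrywise X -> entrywise Y -> entrywise (fun om => X om + Y om).
Proof.
by move=> hX hY i j; under eq_fun do rewrite mxE; exact: F_add.
Qed.

Lemma entrywise_opp m n (X : T -> 'M[R]_(m, n)) :
  entrywise X -> entrywise (fun om => - X om).
Proof.
move=> hX i j; under eq_fun do rewrite mxE -mulN1r; exact: F_scale.
Qed.

Lemma entrywise_sub m n (X Y : T -> 'M[R]_(m, n)) :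
  entrywise X -> entrywise Y -> entrywise (fun om => X om - Y om).
Proof. by move=> hX hY; apply: entrywise_add => //; exact: entrywise_opp. Qed.

Lemma entrywise_mull m n p (M : 'M[R]_(m, n)) (X : T -> 'M[R]_(n, p)) :
  entrywise X -> entrywise (fun om => M *m X om).
Proof.
move=> hX i j; under eq_fun do rewrite mxE.
by apply: closed_sum => // k; exact: F_scale.
Qed.

End entrywise.

Lemma mx_measurableP (R : realType) (T : pointedType) (G : set (set T)) m n
    (X : T -> 'M[R]_(m, n)) : sigma_algebra setT G ->
  mx_measurable G X <-> entrywise (mfun_wrt G) X.
Proof.
move=> sG; split=> [h i j _ [B mB <-]|h].
  apply: h; exists [set M : 'M[R]_(m, n) | B (M i j)] => //.
  by apply: sub_sigma_algebra; exists i, j; exists B.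
rewrite /mx_measurable /sigma_of /mx_borel.
set gen := (gen in <<s gen >>).
rewrite -[S in S `<=` _](g_sigma_preimageE setT X gen).
apply: smallest_sub => //.
move=> _ [_ [i [j [D mD ->]]] <-].
by apply: (h i j); exists D.
Qed.

Lemma dotvE (R : realType) n (x y : 'cV[R]_n) : dotv x y = \sum_i x i 0 * y i 0.
Proof. by rewrite /dotv mxE; apply: eq_bigr => i _; rewrite mxE. Qed.

Lemma qform_dotv (R : realType) n (M : 'M[R]_n) (x : 'cV[R]_n) : qform M x = dotv x (M *m x).
Proof. by rewrite /qform /dotv mulmxA. Qed.

Lemma qform_tr (R : realType) n (M : 'M[R]_n) (x : 'cV[R]_n) :
  qform M x = \tr (M *m (x *m x^T)).
Proof. by rewrite mulmxA mxtrace_mulC mulmxA trace_mx11. Qed.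

Section measurable_entries.
Context {R : realType} {T : pointedType}.
Variables (G : set (set T)) (saG : sigma_algebra setT G).

Lemma mfun_entrywise_mull m n p (M : 'M[R]_(m, n)) (X : T -> 'M[R]_(n, p)) :
  entrywise (mfun_wrt G) X -> entrywise (mfun_wrt G) (fun om => M *m X om).
Proof.
apply: entrywise_mull.
- by move=> c; exact: mfun_wrt_cst.
- by move=> f g; exact: mfun_wrtD.
- by move=> c f; apply: mfun_wrtM => //; exact: mfun_wrt_cst.
Qed.

Lemma mfun_entrywise_add m n (X Y : T -> 'M[R]_(m, n)) :
  entrywise (mfun_wrt G) X -> entrywise (mfun_wrt G) Y ->
  entrywise (mfun_wrt G) (fun om => X om + Y om).
Proof. by apply: entrywise_add => f g; exact: mfun_wrtD. Qed.

Lemma mfun_entrywise_sub m n (X Y : T -> 'M[R]_(m, n)) :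
  entrywise (mfun_wrt G) X -> entrywise (mfun_wrt G) Y ->
  entrywise (mfun_wrt G) (fun om => X om - Y om).
Proof.
apply: entrywise_sub => [f g|c f]; first exact: mfun_wrtD.
by apply: mfun_wrtM => //; exact: mfun_wrt_cst.
Qed.

Lemma mfun_entrywise_cst m n (M : 'M[R]_(m, n)) : entrywise (mfun_wrt G) (fun=> M).
Proof. by apply: entrywise_cst => c; exact: mfun_wrt_cst. Qed.

Lemma mfun_dotv n (X Y : T -> 'cV[R]_n) :
  entrywise (mfun_wrt G) X -> entrywise (mfun_wrt G) Y ->
  mfun_wrt G (fun om => dotv (X om) (Y om)).
Proof.
move=> hX hY; under eq_fun do rewrite dotvE.
by apply: mfun_wrt_sum => // i; exact: mfun_wrtM.
Qed.

Lemma mfun_qform n (M : 'M[R]_n) (X : T -> 'cV[R]_n) :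
  entrywise (mfun_wrt G) X -> mfun_wrt G (fun om => qform M (X om)).
Proof.
move=> hX; under eq_fun do rewrite qform_dotv.
by apply: mfun_dotv => //; exact: mfun_entrywise_mull.
Qed.

End measurable_entries.

Section random_matrices.
Context {R : realType} {d : measure_display} {T : measurableType d}.
Variable P : probability T R.
Implicit Types (G H : set (set T)).

Lemma mx_measurable_entrywise m n (X : T -> 'M[R]_(m, n)) :
  mx_measurable measurable X <-> entrywise (measurable_fun setT) X.
Proof.
have sM := sigma_algebra_measurable T.
rewrite (mx_measurableP _ sM); split=> h i j.
  exact: (mfun_wrt_measurable _ (h i j)).
by move=> _ [B mB <-]; exact: h.
Qed.

Local Notation L2 := (L2 P).
Local Notation ce := (ce P).
Local Notation integrable1 := (integrable1 P).

Lemma norm2_sqr n (x : 'cV[R]_n) : norm2 x ^+ 2 = \sum_i x i 0 ^+ 2.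
Proof. by rewrite sqr_sqrtr// sumr_ge0// => i _; exact: sqr_ge0. Qed.

Lemma sqr_le_norm2 n (x : 'cV[R]_n) i : x i 0 ^+ 2 <= norm2 x ^+ 2.
Proof.
by rewrite norm2_sqr (bigD1 i)//= lerDl sumr_ge0// => j _; exact: sqr_ge0.
Qed.

Lemma measurable_norm2_sqr n (X : T -> 'cV[R]_n) :
  entrywise (measurable_fun setT) X -> measurable_fun setT (fun om => norm2 (X om) ^+ 2).
Proof.
move=> mX; under eq_fun do rewrite norm2_sqr.
apply: (@closed_sum R T _ (measurable_fun (setT : set T))).
- exact: measurable_cst.
- by move=> f g mf mg; exact: measurable_funD.
- by move=> i; exact: measurable_funX.
Qed.

Lemma square_integrableP n (X : T -> 'cV[R]_n) :
  entrywise (measurable_fun setT) X ->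
  square_integrable P X <-> entrywise L2 X.
Proof.
move=> mX; have mN := measurable_norm2_sqr mX.
have -> : square_integrable P X <-> integrable1 (fun om => norm2 (X om) ^+ 2).
  rewrite /square_integrable unlock; split=> [h|/integrableP[_]].
    apply/integrableP; split; first exact/measurable_EFinP.
    by under eq_integral do rewrite /= ger0_norm ?sqr_ge0//.
  by under eq_integral do rewrite /= ger0_norm ?sqr_ge0//.
split=> [iN i j|hX].
  rewrite (ord1 j); split; first exact: mX.
  apply: (integrable1_le _ iN); first exact: measurable_funX.
  by move=> om; rewrite ger0_norm ?sqr_ge0// sqr_le_norm2.
under eq_fun do rewrite norm2_sqr.
by apply: integrable1_sum => i; exact: (hX i 0).2.
Qed.

Lemma L2_entrywise_mull m n p (M : 'M[R]_(m, n)) (X : T -> 'M[R]_(n, p)) :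
  entrywise L2 X -> entrywise L2 (fun om => M *m X om).
Proof.
by apply: entrywise_mull; [exact: L2_cst|exact: L2D|exact: L2Z].
Qed.

Lemma L2_entrywise_add m n (X Y : T -> 'M[R]_(m, n)) :
  entrywise L2 X -> entrywise L2 Y -> entrywise L2 (fun om => X om + Y om).
Proof. by apply: entrywise_add; exact: L2D. Qed.

Lemma L2_entrywise_sub m n (X Y : T -> 'M[R]_(m, n)) :
  entrywise L2 X -> entrywise L2 Y -> entrywise L2 (fun om => X om - Y om).
Proof. by apply: entrywise_sub; [exact: L2D|exact: L2Z]. Qed.

Lemma L2_entrywise_cst m n (M : 'M[R]_(m, n)) : entrywise L2 (fun=> M).
Proof. by apply: entrywise_cst; exact: L2_cst. Qed.

Lemma integrable_dotv n (X Y : T -> 'cV[R]_n) :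
  entrywise L2 X -> entrywise L2 Y -> integrable1 (fun om => dotv (X om) (Y om)).
Proof.
move=> hX hY; under eq_fun do rewrite dotvE.
by apply: integrable1_sum => i; exact: L2M.
Qed.

Lemma integrable_qform n (M : 'M[R]_n) (X : T -> 'cV[R]_n) :
  entrywise L2 X -> integrable1 (fun om => qform M (X om)).
Proof.
move=> hX; under eq_fun do rewrite qform_dotv.
by apply: integrable_dotv => //; exact: L2_entrywise_mull.
Qed.

Lemma integrable_outer m n (X : T -> 'cV[R]_m) (Y : T -> 'cV[R]_n) :
  entrywise L2 X -> entrywise L2 Y ->
  entrywise integrable1 (fun om => X om *m (Y om)^T).
Proof.
move=> hX hY i j; under eq_fun do rewrite mxE.
by apply: integrable1_sum => k; under eq_fun do rewrite mxE; exact: L2M.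
Qed.

Section matrix_cond_expect.
Variables (G : set (set T)) (sG : sub_sigma G).

Definition mxce m n (X Z : T -> 'M[R]_(m, n)) : Prop :=
  forall i j, ce G (fun om => X om i j) (fun om => Z om i j).

Lemma mxce_cond_expect m n (X : T -> 'M[R]_(m, n)) :
  entrywise integrable1 X -> mxce X (cond_expect_mx P G X).
Proof.
by move=> iX i j; under [Z in ce _ _ Z]eq_fun do rewrite mxE; exact: ce_cond_expect.
Qed.

Lemma mxce_mfun m n (X Z : T -> 'M[R]_(m, n)) :
  mxce X Z -> entrywise (mfun_wrt G) Z.
Proof. by move=> h i j; exact: ce_mfun (h i j). Qed.

Lemma mxce_L2 m n (X Z : T -> 'M[R]_(m, n)) :
  entrywise L2 X -> mxce X Z -> entrywise L2 Z.
Proof. by move=> hX h i j; exact: ce_L2 sG (hX i j) (h i j). Qed.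

Lemma mxce_self m n (X : T -> 'M[R]_(m, n)) :
  entrywise (mfun_wrt G) X -> entrywise integrable1 X -> mxce X X.
Proof. by move=> mX iX i j; exact: ce_self. Qed.

Lemma mxceD m n (X Y Z W : T -> 'M[R]_(m, n)) : mxce X Z -> mxce Y W ->
  mxce (fun om => X om + Y om) (fun om => Z om + W om).
Proof.
move=> cX cY i j; have := ceD sG (cX i j) (cY i j).
by congr ce; apply/funext => om; rewrite mxE.
Qed.

Lemma mxceB m n (X Y Z W : T -> 'M[R]_(m, n)) : mxce X Z -> mxce Y W ->
  mxce (fun om => X om - Y om) (fun om => Z om - W om).
Proof.
move=> cX cY i j; have := ceB sG (cX i j) (cY i j).
by congr ce; apply/funext => om; rewrite !mxE.
Qed.

Lemma mxce_mull m n p (M : 'M[R]_(m, n)) (X Z : T -> 'M[R]_(n, p)) :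
  mxce X Z -> mxce (fun om => M *m X om) (fun om => M *m Z om).
Proof.
move=> cX i j.
have := ce_sum (index_enum 'I_n) sG (fun k => ceZ (M i k) sG (cX k j)).
by congr ce; apply/funext => om; rewrite mxE.
Qed.

Lemma mxce_trace n (X Z : T -> 'M[R]_n) : mxce X Z ->
  ce G (fun om => \tr (X om)) (fun om => \tr (Z om)).
Proof. by move=> cX; apply: ce_sum => // i; exact: cX. Qed.

Lemma mxce_dotv n (X Y Z : T -> 'cV[R]_n) :
  entrywise L2 X -> entrywise L2 Y -> entrywise (mfun_wrt G) Y -> mxce X Z ->
  ce G (fun om => dotv (Y om) (X om)) (fun om => dotv (Y om) (Z om)).
Proof.
move=> hX hY mY cX.
have := ce_sum (index_enum 'I_n) sG
  (fun i => ceM_L2 sG (hX i 0) (hY i 0) (mY i 0) (cX i 0)).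
by congr ce; apply/funext => om; rewrite dotvE.
Qed.

Lemma mxce_ae_uniq m n (X Y Z W : T -> 'M[R]_(m, n)) : mxce X Z -> mxce Y W ->
  {ae P, forall om, X om = Y om} -> {ae P, forall om, Z om = W om}.
Proof.
move=> cX cY XY.
have : {ae P, forall om, forall i, forall j, Z om i j = W om i j}.
  apply: filter_forall => i; apply: filter_forall => j.
  by apply: (ce_ae_uniq sG (cX i j) (cY i j)); apply: filterS XY => om ->.
by apply: filterS => om h; apply/matrixP.
Qed.

End matrix_cond_expect.

End random_matrices.

(** * Quadratic forms *)

Section quadratic_forms.
Context {R : realType}.

Lemma dotvC n (x y : 'cV[R]_n) : dotv x y = dotv y x.
Proof. by rewrite !dotvE; apply: eq_bigr => i _; rewrite mulrC. Qed.

Lemma dotvDr n (x y z : 'cV[R]_n) : dotv x (y + z) = dotv x y + dotv x z.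
Proof. by rewrite /dotv mulmxDr mxE. Qed.

Lemma dotvNr n (x y : 'cV[R]_n) : dotv x (- y) = - dotv x y.
Proof. by rewrite /dotv mulmxN mxE. Qed.

Lemma dotvZr n c (x y : 'cV[R]_n) : dotv x (c *: y) = c * dotv x y.
Proof. by rewrite /dotv -scalemxAr mxE. Qed.

Lemma dotvDl n (x y z : 'cV[R]_n) : dotv (y + z) x = dotv y x + dotv z x.
Proof. by rewrite !(dotvC _ x) dotvDr. Qed.

Lemma dotvNl n (x y : 'cV[R]_n) : dotv (- y) x = - dotv y x.
Proof. by rewrite !(dotvC _ x) dotvNr. Qed.

Lemma dotv_mull m n (M : 'M[R]_(m, n)) (x : 'cV[R]_n) (y : 'cV[R]_m) :
  dotv (M *m x) y = dotv x (M^T *m y).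
Proof. by rewrite /dotv trmx_mul mulmxA. Qed.

Lemma qformD n (V : 'M[R]_n) (x y : 'cV[R]_n) : V^T = V ->
  qform V (x + y) = qform V x + 2 * dotv x (V *m y) + qform V y.
Proof.
move=> sV; rewrite !qform_dotv mulmxDr dotvDr !dotvDl.
have -> : dotv y (V *m x) = dotv x (V *m y) by rewrite dotvC dotv_mull sV.
by ring.
Qed.

Lemma qformN n (V : 'M[R]_n) (x : 'cV[R]_n) : qform V (- x) = qform V x.
Proof. by rewrite !qform_dotv mulmxN dotvNr dotvNl opprK. Qed.

Lemma qformDm n (V W : 'M[R]_n) (x : 'cV[R]_n) :
  qform (V + W) x = qform V x + qform W x.
Proof. by rewrite !qform_dotv mulmxDl dotvDr. Qed.

Lemma qformZm n c (V : 'M[R]_n) (x : 'cV[R]_n) :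
  qform (c *: V) x = c * qform V x.
Proof. by rewrite !qform_dotv -scalemxAl dotvZr. Qed.

Lemma qform_congr m n (V : 'M[R]_n) (B : 'M[R]_(n, m)) (x : 'cV[R]_m) :
  qform (B^T *m V *m B) x = qform V (B *m x).
Proof. by rewrite !qform_dotv dotv_mull !mulmxA. Qed.

Lemma possemidefD n (V W : 'M[R]_n) :
  possemidef V -> possemidef W -> possemidef (V + W).
Proof.
move=> [sV V0] [sW W0]; split; first by rewrite linearD/= sV sW.
by move=> x; rewrite qformDm addr_ge0.
Qed.

Lemma possemidefZ n c (V : 'M[R]_n) : 0 <= c -> possemidef V -> possemidef (c *: V).
Proof.
move=> c0 [sV V0]; split; first by rewrite linearZ/= sV.
by move=> x; rewrite qformZm mulr_ge0.
Qed.

Lemma possemidef_congr m n (V : 'M[R]_n) (B : 'M[R]_(n, m)) :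
  possemidef V -> possemidef (B^T *m V *m B).
Proof.
move=> [sV V0]; split; last by move=> x; rewrite qform_congr.
by rewrite !trmx_mul trmxK sV mulmxA.
Qed.

Lemma posdef_possemidef n (V : 'M[R]_n) : posdef V -> possemidef V.
Proof.
move=> [sV V0]; split=> // x; have [->|/V0/ltW//] := eqVneq x 0.
by rewrite qform_dotv mulmx0 dotvE big1// => i _; rewrite mxE mul0r.
Qed.

Lemma posdefD n (V W : 'M[R]_n) : possemidef V -> posdef W -> posdef (V + W).
Proof.
move=> [sV V0] [sW W0]; split; first by rewrite linearD/= sV sW.
by move=> x x0; rewrite qformDm ltr_wpDl// W0.
Qed.

(** A nonzero vector of the kernel would be isotropic. *)
Lemma posdef_unitmx n (V : 'M[R]_n) : posdef V -> V \in unitmx.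
Proof.
move=> [_ V0]; rewrite -row_free_unit -kermx_eq0; apply/negPn/negP => k0.
have [i ki] : exists i, row i (kermx V) != 0.
  apply/existsP; apply: contraNT k0 => /existsPn k0.
  by apply/eqP/row_matrixP => i; rewrite row0; apply/eqP/negPn/k0.
have kV : row i (kermx V) *m V = 0 by apply/sub_kermxP; exact: row_sub.
have := V0 (row i (kermx V))^T; rewrite trmx_eq0 ki => /(_ isT).
by rewrite /qform trmxK kV mul0mx mxE ltxx.
Qed.

(** One step of the linear-quadratic recursion, along a single trajectory. With
    value function z |-> z^T V z + 2 z^T a at the next state
    z = A x + B u + wb + dl, the sum of the next value and of the stage cost is
    quadratic in u, with Hessian G and, up to dl, with minimizer K x + h;
    completing the square leaves a quadratic function of x of the same form,
    with coefficients V' and a', plus terms in dl. The hypotheses on K and h are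
    the normal equations of the minimization, the one on a' is doubled to avoid
    fractions. *)
Lemma complete_square n m (A V Q V' : 'M[R]_n) (B : 'M[R]_(n, m)) (Ru : 'M[R]_m)
    (K : 'M[R]_(m, n)) (h u : 'cV[R]_m) (a a' M wb x dl : 'cV[R]_n) :
  let G := B^T *m V *m B + Ru in
  V^T = V -> Ru^T = Ru ->
  G *m K = - (B^T *m V *m A) -> G *m h = - (B^T *m (V *m wb + a)) ->
  V' = A^T *m V *m A + Q - K^T *m G *m K ->
  2 *: a' = 2 *: ((A + B *m K)^T *m (V *m wb + a)) + M ->
  qform V (A *m x + B *m u + (wb + dl))
    + 2 * dotv (A *m x + B *m u + (wb + dl)) a
    + (qform Q x + dotv x M + qform Ru u)
  = qform V' x + 2 * dotv x a' + qform G (u - (K *m x + h))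
    + (qform V wb + 2 * dotv wb a - qform G h)
    + 2 * dotv dl (V *m (A *m x + B *m u) + V *m wb + a) + qform V dl.
Proof.
move=> G sV sR GK Gh V'E a'E.
have sG : G^T = G by rewrite linearD/= sR !trmx_mul trmxK sV mulmxA.
have a'x : 2 * dotv x a' =
    2 * (dotv (A *m x) (V *m wb + a) + dotv (B *m (K *m x)) (V *m wb + a)) + dotv x M.
  by rewrite -dotvZr a'E dotvDr dotvZr -dotv_mull mulmxDl dotvDl mulmxA.
have V'x : qform V' x = qform V (A *m x) + qform Q x - qform G (K *m x).
  by rewrite V'E -!qform_congr -!qformDm -[in RHS]mulN1r -qformZm -qformDm scaleN1r.
have Gu : qform G u = qform V (B *m u) + qform Ru u.
  by rewrite /G qformDm qform_congr.
have sq : qform G (u - (K *m x + h)) =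
   qform G u + 2 * (dotv (B *m u) (V *m (A *m x)) + dotv (B *m u) (V *m wb + a))
   + qform G (K *m x) - 2 * dotv (B *m (K *m x)) (V *m wb + a) + qform G h.
  have GKh : G *m (K *m x + h)
      = - (B^T *m (V *m (A *m x))) - B^T *m (V *m wb + a).
    by rewrite mulmxDr Gh mulmxA GK mulNmx !mulmxA.
  have Bdot (z : 'cV[R]_m) y : dotv z (B^T *m y) = dotv (B *m z) y.
    by rewrite dotv_mull.
  rewrite qformD// qformN mulmxN dotvNr GKh qformD// Gh.
  by rewrite dotvDr !dotvNr !Bdot; ring.
rewrite a'x V'x sq Gu.
rewrite (qformD _ (wb + dl) sV) (qformD (A *m x) _ sV) (qformD wb _ sV).
rewrite !mulmxDr !dotvDr !dotvDl.
have sym y z : dotv y (V *m z) = dotv z (V *m y) by rewrite dotvC dotv_mull sV.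
rewrite (sym dl (A *m x)) (sym dl (B *m u)) (sym dl wb).
by rewrite (sym (B *m u) (A *m x)); ring.
Qed.

End quadratic_forms.

(** * Independence and identical distribution *)

Section independence.
Context {R : realType} {d : measure_display} {T : measurableType d}.
Variable P : probability T R.

(** A pi-system that generates the joint sigma-algebra of the G i, i in s, and on
    which mutual independence gives the probability. *)
Definition cylinders (I : eqType) (G : I -> set (set T)) (s : seq I) : set (set T) :=
  [set A | exists2 E : I -> set T, (forall i, G i (E i)) &
             A = \big[setI/setT]_(i <- s) E i].

Definition joint_sigma (I : eqType) (G : I -> set (set T)) (s : seq I) :=
  <<s cylinders G s >>.

Section family.
Variables (I : eqType) (G : I -> set (set T)).
Hypothesis sG : forall i, sub_sigma (G i).

Let GT i : G i setT.
Proof. by rewrite -(setD0 setT); case: (sG i).1 => G0 GC _; exact: GC. Qed.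

Let GI i A B : G i A -> G i B -> G i (A `&` B).
Proof.
rewrite -[G i](measurable_g_measurableTypeE (sG i).1).
exact: (@measurableI _ (g_sigma_algebraType (G i))).
Qed.

Lemma sub_joint_sigma (s : seq I) i : i \in s -> G i `<=` joint_sigma G s.
Proof.
move=> si A GA; apply: sub_sigma_algebra.
exists (fun j => if j == i then A else setT).
  by move=> j; case: eqP => [->|_] //; exact: GT.
apply/seteqP; split=> x.
  move=> Ax; elim: s {si} => [|j s IH]; first by rewrite big_nil.
  by rewrite big_cons; split => //; case: eqP.
elim: s si => // j s IH; rewrite inE big_cons => /orP[/eqP <- []|/IH h []//].
by rewrite eqxx.
Qed.

Lemma joint_sigma_min (s : seq I) (H : set (set T)) : sigma_algebra setT H ->
  (forall i, i \in s -> G i `<=` H) -> joint_sigma G s `<=` H.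
Proof.
move=> sH GH; apply: smallest_sub => // _ [E GE ->].
have GEH i : i \in s -> H (E i) by move=> /GH; apply; exact: GE.
elim: s GH GEH => [|i s IH] GH GEH.
  by rewrite big_nil -(setD0 setT); case: sH => H0 HC _; exact: HC.
rewrite big_cons.
rewrite -[H](measurable_g_measurableTypeE sH).
apply: (@measurableI _ (g_sigma_algebraType H));
  rewrite measurable_g_measurableTypeE//; first by apply: GEH; rewrite mem_head.
by apply: IH => j js; [apply: GH|apply: GEH]; rewrite inE js orbT.
Qed.

Lemma sub_sigma_joint (s : seq I) : sub_sigma (joint_sigma G s).
Proof.
split; first exact: smallest_sigma_algebra.
apply: joint_sigma_min; first exact: sigma_algebra_measurable.
by move=> i _; exact: (sG i).2.
Qed.

(** A |-> P(A cap B) and A |-> P(B) P(A) are finite measures that agree on the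
    cylinders. *)
Lemma independent_joint (s : seq I) i0 A B : mutually_independent P G ->
  uniq (i0 :: s) -> joint_sigma G s A -> G i0 B ->
  (P (A `&` B) = P A * P B)%E.
Proof.
move=> ind us sA GB; have mB := (sG i0).2 _ GB.
have pB : P B \is a fin_num by exact: fin_num_measure.
pose c : {nonneg R} := NngNum (fine_ge0 (measure_ge0 P B)).
pose m1 : {measure set T -> \bar R} := mrestr P mB.
pose m2 : {measure set T -> \bar R} := mscale c P.
rewrite -[LHS]/(m1 A) muleC -(fineK pB) -[RHS]/(m2 A).
apply: (@g_sigma_algebra_measure_unique _ _ _ (cylinders G s) _ (fun=> setT) _ _ m1 m2) => //.
- move=> C CC; apply: (sub_sigma_joint s).2; exact: sub_sigma_algebra.
- move=> k; exists (fun=> setT) => //; elim: s {us sA} => [|j s IH].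
    by rewrite big_nil.
  by rewrite big_cons setTI.
- by rewrite bigcup_const.
- move=> _ _ [E GE ->] [F GF ->]; exists (fun i => E i `&` F i).
    by move=> i; exact: GI.
  by rewrite big_split.
- move=> _ [E GE ->]; rewrite /m1/= /mrestr /m2/= /mscale/= fineK//.
  pose E' i := if i == i0 then B else E i.
  have E's : \big[setI/setT]_(i <- s) E' i = \big[setI/setT]_(i <- s) E i.
    apply: eq_big_seq => i si; rewrite /E'; case: eqP => // ii.
    by move: us; rewrite /= -ii si.
  have us' : uniq s by case/andP: us.
  have E'0 : E' i0 = B by rewrite /E' eqxx.
  have := ind _ E' us; rewrite !big_cons E's E'0 setIC => ->; last first.
    by move=> i _; rewrite /E'; case: eqP => [->|].
  rewrite -E's (ind _ E' us')//.
  by move=> i _; rewrite /E'; case: eqP => [->|].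
- by move=> k; rewrite -[m1 _]/(P (setT `&` B)) setTI ltey_eq pB.
Qed.

End family.

(** Both sides integrate the identity for the law of f o X i, which is the law
    of f o X j. *)
Lemma identically_distributed_integral (I : Type) m n
    (X : I -> T -> 'M[R]_(m, n)) (f : 'M[R]_(m, n) -> R) i j :
  identically_distributed P X -> mfun_wrt (@mx_borel R m n) f ->
  integrable1 P (f \o X i) -> integrable1 P (f \o X j) ->
  (\int[P]_x (f (X i x))%:E = \int[P]_x (f (X j x))%:E)%E.
Proof.
move=> idX mf iXi iXj.
have mi := integrable1_measurable iXi; have mj := integrable1_measurable iXj.
pose gi : {mfun T >-> R} :=
  MeasurableFun.Pack (MeasurableFun.Class (isMeasurableFun.Build _ _ _ _ _ mi)).
pose gj : {mfun T >-> R} :=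
  MeasurableFun.Pack (MeasurableFun.Class (isMeasurableFun.Build _ _ _ _ _ mj)).
have mE : measurable_fun setT (EFin : R -> \bar R) by [].
rewrite -[LHS](@integral_distribution _ _ _ _ _ P gi (EFin : R -> \bar R))//.
rewrite -[RHS](@integral_distribution _ _ _ _ _ P gj (EFin : R -> \bar R))//.
apply: eq_measure_integral => D mD _.
rewrite /= /distribution /pushforward/=.
have fD : mx_borel (f @^-1` D) by apply: mf; exists D; rewrite ?setTI.
exact: (idX i j _ fD).
Qed.

End independence.

(** * The noise *)

Section noise.
Context {R : realType} {d : measure_display} {T : measurableType d}.
Context {P : probability T R} {n m q : nat} (S : lq_system P n m q).
Hypothesis hx0 : mx_measurable measurable (x0 S).
Hypothesis hw : forall t, mx_measurable measurable (w S t).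
Hypothesis heps : forall t, mx_measurable measurable (eps S t).

Lemma sigma_of_sigma_algebra k l (X : T -> 'M[R]_(k, l)) :
  sigma_algebra setT (sigma_of X).
Proof. exact: sigma_algebra_preimage (smallest_sigma_algebra _ _). Qed.

Lemma sigma_of_entrywise k l (X : T -> 'M[R]_(k, l)) :
  entrywise (mfun_wrt (sigma_of X)) X.
Proof. by apply/mx_measurableP => //; exact: sigma_of_sigma_algebra. Qed.

Lemma entrywise_col_mx (F : (T -> R) -> Prop) k l (X : T -> 'cV[R]_k)
    (Y : T -> 'cV[R]_l) :
  entrywise F (fun om => col_mx (X om) (Y om)) <-> entrywise F X /\ entrywise F Y.
Proof.
split=> [h|[hX hY] i j].
  split=> i j; [have := h (lshift l i) j|have := h (rshift k i) j];
    by under eq_fun do rewrite ?col_mxEu ?col_mxEd.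
rewrite -(splitK i); case: (fintype.split i) => k' /=;
  by under eq_fun do rewrite ?col_mxEu ?col_mxEd.
Qed.

Lemma sub_sigma_source i : sub_sigma (source_sigma S i).
Proof.
have sM := sigma_algebra_measurable T.
case: i => [t|] /=; split; [exact: sigma_of_sigma_algebra|
  |exact: sigma_of_sigma_algebra|exact: hx0].
apply/(mx_measurableP _ sM)/entrywise_col_mx; split.
  by apply/mx_measurableP => //; exact: hw.
by apply/mx_measurableP => //; exact: heps.
Qed.

Definition noise_index t : seq (option nat) := None :: map some (iota 0 t.+1).

Lemma mem_noise_index r t : (Some r \in noise_index t) = (r <= t)%N.
Proof.
by rewrite in_cons orFb mem_map ?mem_iota ?add0n//; exact: Some_inj.
Qed.

(** Everything random up to time t, observed or not. It contains the
    observations, and the next noise is independent of it. *)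
Definition past t : set (set T) := joint_sigma (source_sigma S) (noise_index t).

Lemma sub_sigma_past t : sub_sigma (past t).
Proof. exact: sub_sigma_joint sub_sigma_source _. Qed.

Lemma entrywise_sub_sigma G H k l (X : T -> 'M[R]_(k, l)) : G `<=` H ->
  entrywise (mfun_wrt G) X -> entrywise (mfun_wrt H) X.
Proof. by move=> GH h i j; exact: mfun_wrt_sub GH (h i j). Qed.

Lemma past_sub s t : (s <= t)%N -> past s `<=` past t.
Proof.
move=> st; apply: joint_sigma_min; first exact: (sub_sigma_past t).1.
move=> i si; apply: sub_joint_sigma; first exact: sub_sigma_source.
case: i si => [r|//]; rewrite !mem_noise_index => rs; exact: leq_trans rs st.
Qed.

Lemma past_x0 t : entrywise (mfun_wrt (past t)) (x0 S).
Proof.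
apply: (@entrywise_sub_sigma (source_sigma S None)); last exact: sigma_of_entrywise.
by apply: sub_joint_sigma; [exact: sub_sigma_source|exact: mem_head].
Qed.

Lemma past_noise s t : (s <= t)%N ->
  entrywise (mfun_wrt (past t)) (w S s) /\ entrywise (mfun_wrt (past t)) (eps S s).
Proof.
move=> st; apply/entrywise_col_mx.
apply: (@entrywise_sub_sigma (source_sigma S (Some s))); last exact: sigma_of_entrywise.
apply: sub_joint_sigma; first exact: sub_sigma_source.
by rewrite mem_noise_index.
Qed.

Lemma past_independent t (Y : T -> R) : mutually_independent P (source_sigma S) ->
  mfun_wrt (source_sigma S (Some t.+1)) Y -> independent_of P (past t) Y.
Proof.
move=> ind mY A D pA mD.
apply: (independent_joint sub_sigma_source ind _ pA (i0 := Some t.+1)); last first.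
  by apply: mY; exists D; rewrite ?setTI.
rewrite cons_uniq mem_noise_index ltnn /= -[X in _ && X]/(uniq (map some (iota 0 t.+1))).
by rewrite (map_inj_uniq (@Some_inj _)) iota_uniq andbT; apply/seq.mapP => -[].
Qed.

End noise.

Section moments.
Context {R : realType} {d : measure_display} {T : measurableType d}.
Variable P : probability T R.

Lemma expect_mxE k l (X : T -> 'M[R]_(k, l)) i j :
  expect_mx P X i j = fine (\int[P]_om (X om i j)%:E).
Proof. by rewrite mxE unlock. Qed.

Lemma trmx_expect_mx k l (X : T -> 'M[R]_(k, l)) :
  (expect_mx P X)^T = expect_mx P (fun om => (X om)^T).
Proof.
apply/matrixP => i j; rewrite mxE !expect_mxE.
by under [in RHS]eq_integral do rewrite mxE.
Qed.

Lemma L2_of_fourth_moment k (X : T -> 'cV[R]_k) :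
  mx_measurable measurable X -> ('E_P[fun om => (norm2 (X om) ^+ 4)%R] < +oo)%E ->
  entrywise (L2 P) X.
Proof.
move=> /mx_measurable_entrywise mX h4.
have m2 := measurable_norm2_sqr mX.
have i4 : integrable1 P (fun om => (norm2 (X om) ^+ 2) ^+ 2).
  apply/integrableP; split; first by apply/measurable_EFinP; exact: measurable_funX.
  move: h4; rewrite unlock; congr (_ < _)%E; apply: eq_integral => om _ /=.
  by rewrite ger0_norm ?sqr_ge0// -exprM.
move=> i j; rewrite (ord1 j); split; first exact: mX.
apply: (integrable1_le _ (integrable1D (integrable1_cst P 1) i4)).
  exact: measurable_funX.
move=> om; rewrite ger0_norm ?sqr_ge0// (le_trans (sqr_le_norm2 _ _))//.
(* x^2 <= 1 + x^4 *)
by nra.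
Qed.

Lemma integral_cst_prob (c : R) : (\int[P]_x c%:E = c%:E)%E.
Proof.
rewrite integral_cst// -[RHS]mule1; congr (_ * _)%E; exact: probability_setT.
Qed.

(** The expectation is the conditional expectation given a trivial sigma-algebra,
    here that of a constant, so it commutes with matrix products like any
    conditional expectation. *)
Lemma expect_dotv_outer k l (X : T -> 'cV[R]_k) (Y : T -> 'cV[R]_l) a b :
  entrywise (L2 P) X -> entrywise (L2 P) Y ->
  (\int[P]_om (dotv a (X om) * dotv b (Y om))%:E =
   (dotv a (expect_mx P (fun om => X om *m (Y om)^T) *m b))%:E)%E.
Proof.
move=> hX hY.
pose G := sigma_of (fun _ : T => 0 : 'cV[R]_1).
have sG : sub_sigma G.
  split; first exact: sigma_of_sigma_algebra.
  move=> _ [B _ <-]; rewrite setTI preimage_cst.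
  by case: ifP => _; [exact: measurableT|exact: measurable0].
have cG (f : T -> R) : integrable1 P f -> ce P G f (fun=> fine (\int[P]_x (f x)%:E)).
  move=> iF; apply: ce_independent => // _ D [B _ <-] mD.
  rewrite setTI preimage_cst; case: ifP => _.
    rewrite setTI -[LHS]mul1e; congr (_ * _)%E; exact/esym/probability_setT.
  by rewrite set0I measure0 mul0e.
have iXY := integrable_outer hX hY.
have cXY : mxce P G (fun om => X om *m (Y om)^T)
    (fun=> expect_mx P (fun om => X om *m (Y om)^T)).
  by move=> i j; rewrite expect_mxE; exact: cG.
have := ce_integral sG (mxce_trace sG (mxce_mull sG (b *m a^T) cXY)).
rewrite integral_cst_prob.
have trE (M : 'M[R]_(k, l)) : \tr (b *m a^T *m M) = dotv a (M *m b).
  by rewrite mxtrace_mulC mulmxA mxtrace_mulC trace_mx11 /dotv.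
rewrite trE => <-; apply: eq_integral => om _; rewrite trE; congr EFin.
rewrite [in RHS]/dotv -mulmxA mulmxA mxE big_ord1; congr (_ * _).
by rewrite dotvC.
Qed.

End moments.

Section noise_moments.
Context {R : realType} {d : measure_display} {T : measurableType d}.
Context {P : probability T R} {n m q : nat} (S : lq_system P n m q).
Hypothesis hx0 : mx_measurable measurable (x0 S).
Hypothesis hw : forall t, mx_measurable measurable (w S t).
Hypothesis heps : forall t, mx_measurable measurable (eps S t).
Hypothesis hw4 : forall t, ('E_P[fun om => (norm2 (w S t om) ^+ 4)%R] < +oo)%E.
Hypothesis heps4 : forall t, ('E_P[fun om => (norm2 (eps S t om) ^+ 4)%R] < +oo)%E.

Lemma L2_w t : entrywise (L2 P) (w S t).
Proof. exact: L2_of_fourth_moment. Qed.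

Lemma L2_eps t : entrywise (L2 P) (eps S t).
Proof. exact: L2_of_fourth_moment. Qed.

Lemma L2_dw : entrywise (L2 P) (dw S).
Proof. by apply: L2_entrywise_sub; [exact: L2_w|exact: L2_entrywise_cst]. Qed.

Lemma L2_deps : entrywise (L2 P) (deps S).
Proof. by apply: L2_entrywise_sub; [exact: L2_eps|exact: L2_entrywise_cst]. Qed.

Lemma trmx_covW : (covW S)^T = covW S.
Proof.
rewrite trmx_expect_mx; congr expect_mx; apply/funext => om.
by rewrite trmx_mul trmxK.
Qed.

Lemma trmx_covE : (covE S)^T = covE S.
Proof.
rewrite trmx_expect_mx; congr expect_mx; apply/funext => om.
by rewrite trmx_mul trmxK.
Qed.

Lemma possemidef_covW : possemidef (covW S).
Proof.
split; first exact: trmx_covW.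
move=> x; rewrite -lee_fin qform_dotv -(expect_dotv_outer x x L2_dw L2_dw).
by apply: integral_ge0 => om _; rewrite lee_fin -expr2 sqr_ge0.
Qed.

(** The quadratic form of the matrix at z is the second moment of z^T dy, that
    is, of (C^T z)^T dw + z^T deps. *)
Lemma possemidef_covY : possemidef (covY S).
Proof.
split.
  rewrite /covY !linearD/= !trmx_mul !trmxK trmx_covW trmx_covE mulmxA.
  by congr (_ + _); rewrite -!addrA; congr (_ + _); rewrite addrC.
move=> z; pose a := (C S)^T *m z.
have Ca (M : 'M[R]_(n, q)) : qform (C S *m M) z = dotv a (M *m z).
  by rewrite qform_dotv -mulmxA /a dotv_mull trmxK.
have -> : qform (covY S) z =
    qform (covW S) a + 2 * dotv a (covH S *m z) + qform (covE S) z.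
  have trH : qform (C S *m covH S)^T z = qform (C S *m covH S) z.
    by rewrite !qform_dotv dotvC dotv_mull trmxK.
  rewrite /covY !qformDm trH Ca.
  have -> : qform (C S *m covW S *m (C S)^T) z = qform (covW S) a.
    by rewrite -qform_congr trmxK.
  by ring.
rewrite -lee_fin; set W := (X in (_ <= X)%E).
suff -> : W = (\int[P]_om ((dotv a (dw S om) + dotv z (deps S om)) ^+ 2)%:E)%E.
  by apply: integral_ge0 => om _; rewrite lee_fin sqr_ge0.
have iM k l (X : T -> 'cV[R]_k) (Y : T -> 'cV[R]_l) x y :
    entrywise (L2 P) X -> entrywise (L2 P) Y ->
    integrable1 P (fun om => dotv x (X om) * dotv y (Y om)).
  move=> hX hY; apply: L2M; under eq_fun do rewrite dotvE;
  by apply: L2_sum => i; exact: L2Z.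
have hd := L2_dw; have he := L2_deps.
rewrite (eq_integral (fun om => (dotv a (dw S om) * dotv a (dw S om)
   + 2 * (dotv a (dw S om) * dotv z (deps S om))
   + dotv z (deps S om) * dotv z (deps S om))%:E)); last first.
  by move=> om _; congr EFin; ring.
rewrite integralD_EFin//; last 2 first.
- by apply: integrable1D; [exact: iM|apply: integrable1Z; exact: iM].
- exact: iM.
rewrite integralD_EFin//; last 2 first.
- exact: iM.
- by apply: integrable1Z; exact: iM.
under [X in (_ + X + _)%E]eq_integral do rewrite /= EFinM.
rewrite integralZl//; last exact: iM.
by rewrite /= !expect_dotv_outer// /W !qform_dotv.
Qed.

Lemma possemidef_Qmu mus muo : possemidef (Q S) -> possemidef (Qs S) ->
  possemidef (Qo S) -> 0 < mus -> 0 < muo -> possemidef (Qmu S mus muo).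
Proof.
move=> hQ [sQs _] [sQo _] mus0 muo0.
apply: possemidefD; first apply: possemidefD => //.
  apply: possemidefZ; first by rewrite mulr_ge0// ltW.
  by rewrite -[X in X *m _ *m _]sQs; apply: possemidef_congr; exact: possemidef_covW.
apply: possemidefZ; first by rewrite mulr_ge0// ltW.
have -> : (C S)^T *m Qo S *m covY S *m Qo S *m C S =
    (Qo S *m C S)^T *m covY S *m (Qo S *m C S).
  by rewrite trmx_mul sQo !mulmxA.
by apply: possemidef_congr; exact: possemidef_covY.
Qed.

End noise_moments.

Section noise_cond_expect.
Context {R : realType} {d : measure_display} {T : measurableType d}.
Context {P : probability T R} {n m q : nat} (S : lq_system P n m q).
Hypothesis hx0 : mx_measurable measurable (x0 S).
Hypothesis hw : forall t, mx_measurable measurable (w S t).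
Hypothesis heps : forall t, mx_measurable measurable (eps S t).
Hypothesis hindep : mutually_independent P (source_sigma S).
Hypothesis hid : identically_distributed P
  (fun (t : nat) (om : T) => col_mx (w S t om) (eps S t om)).
Hypothesis hw4 : forall t, ('E_P[fun om => (norm2 (w S t om) ^+ 4)%R] < +oo)%E.

(** Independence makes the conditional expectation constant, and identical
    distribution moves the constant to time 0, where the noise moments are
    taken. *)
Lemma ce_next_noise t (f : 'cV[R]_(n + q) -> R) :
  mfun_wrt (@mx_borel R (n + q) 1) f ->
  (forall s, integrable1 P (fun om => f (col_mx (w S s om) (eps S s om)))) ->
  ce P (past S t) (fun om => f (col_mx (w S t.+1 om) (eps S t.+1 om)))
    (fun=> fine (\int[P]_om (f (col_mx (w S 0 om) (eps S 0 om)))%:E)).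
Proof.
move=> mf iF.
rewrite (identically_distributed_integral (j := t.+1) hid mf (iF _) (iF _)).
apply: ce_independent => //; first exact: sub_sigma_past.
apply: past_independent => //.
move=> _ [B mB <-].
exists (f @^-1` B) => //.
by apply: mf; exists B; rewrite ?setTI.
Qed.

Let borelP k l : sigma_algebra setT (@mx_borel R k l) := smallest_sigma_algebra _ _.

Let borel_w : entrywise (mfun_wrt (@mx_borel R (n + q) 1))
  (fun M : 'cV[R]_(n + q) => usubmx M).
Proof.
move=> i j _ [D mD <-]; apply: sub_sigma_algebra.
exists (lshift q i), j, D => //; apply/seteqP; split=> M /=; rewrite ?mxE//.
  by case.
Qed.

Let borel_dw : entrywise (mfun_wrt (@mx_borel R (n + q) 1))
  (fun M : 'cV[R]_(n + q) => usubmx M - wbar S).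
Proof.
apply: (mfun_entrywise_sub (borelP _ _)) borel_w _.
exact: (mfun_entrywise_cst (borelP _ _)).
Qed.

Lemma mxce_next_noise t :
  mxce P (past S t) (fun om => w S t.+1 om - wbar S) (fun=> 0).
Proof.
have hL s := L2_w hw hw4 s.
have sP := sub_sigma_past hx0 hw heps t.
suff cw : mxce P (past S t) (w S t.+1) (fun=> wbar S).
  have := mxceB sP cw (mxce_self (@mfun_entrywise_cst R T _ sP.1 n 1 (wbar S))
    (fun i j => integrable1_cst P (wbar S i j))).
  by congr mxce; apply/funext => om; rewrite subrr.
move=> i j; rewrite expect_mxE.
have := @ce_next_noise t (fun M => usubmx M i j) (@borel_w i j).
under eq_fun do rewrite col_mxKu.
under [in X in ce _ _ _ X]eq_fun do under eq_integral do rewrite col_mxKu.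
apply=> s; under eq_fun do rewrite col_mxKu.
exact: L2_integrable (hL s i j).
Qed.

Lemma mxce_next_noise_outer t :
  mxce P (past S t) (fun om => (w S t.+1 om - wbar S) *m (w S t.+1 om - wbar S)^T)
    (fun=> covW S).
Proof.
have hL s : entrywise (L2 P) (fun om => w S s om - wbar S).
  by apply: L2_entrywise_sub; [exact: L2_w|exact: L2_entrywise_cst].
move=> i j; rewrite expect_mxE.
pose f (M : 'cV[R]_(n + q)) := ((usubmx M - wbar S) *m (usubmx M - wbar S)^T) i j.
have fE s om : ((w S s om - wbar S) *m (w S s om - wbar S)^T) i j
    = f (col_mx (w S s om) (eps S s om)) by rewrite /f col_mxKu.
have -> : (\int[P]_om ((dw S om *m (dw S om)^T) i j)%:E
    = \int[P]_om (f (col_mx (w S 0 om) (eps S 0 om)))%:E)%E.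
  by apply: eq_integral => om _; rewrite -fE.
under [X in ce _ _ X]eq_fun do rewrite fE.
apply: ce_next_noise => [|s]; last first.
  by have := integrable_outer (hL s) (hL s) i j; under eq_fun do rewrite fE.
rewrite /f.
under eq_fun do rewrite mxE.
apply: (@mfun_wrt_sum R _ _ _ _ _ (borelP (n + q) 1)) => k.
under eq_fun do rewrite [_^T _ _]mxE.
apply: (mfun_wrtM (borelP _ _)).
  exact: borel_dw.
exact: borel_dw.
Qed.

End noise_cond_expect.

(** * The observation filtration does not depend on the control *)

Section filtration.
Context {R : realType} {d : measure_display} {T : measurableType d}.
Context {P : probability T R} {n m q : nat} (S : lq_system P n m q).
Implicit Types (u v : nat -> T -> 'cV[R]_m) (G H : set (set T)).

Lemma filt_sigma_algebra u t : sigma_algebra setT (filt S u t).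
Proof. exact: smallest_sigma_algebra. Qed.

Lemma filt_output u s t : (s <= t)%N ->
  entrywise (mfun_wrt (filt S u t)) (output S u s).
Proof.
move=> st; apply/(mx_measurableP _ (filt_sigma_algebra u t)) => D hD.
by apply: sub_sigma_algebra; left; exists s.
Qed.

Lemma filt_input u s t : (s < t)%N -> entrywise (mfun_wrt (filt S u t)) (u s).
Proof.
move=> st; apply/(mx_measurableP _ (filt_sigma_algebra u t)) => D hD.
by apply: sub_sigma_algebra; right; exists s.
Qed.

Lemma filt_min u t H : sigma_algebra setT H ->
  (forall s, (s <= t)%N -> entrywise (mfun_wrt H) (output S u s)) ->
  (forall s, (s < t)%N -> entrywise (mfun_wrt H) (u s)) ->
  filt S u t `<=` H.
Proof.
move=> sH hy hu; apply: smallest_sub => // D [[s st]|[s st]].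
  exact: ((mx_measurableP _ sH).2 (hy s st) D).
exact: ((mx_measurableP _ sH).2 (hu s st) D).
Qed.

Lemma filt_sub u s t : (s <= t)%N -> filt S u s `<=` filt S u t.
Proof.
move=> st; apply: filt_min; first exact: filt_sigma_algebra.
  by move=> r rs; apply: filt_output; exact: leq_trans rs st.
by move=> r rs; apply: filt_input; exact: leq_trans rs st.
Qed.

Definition no_control : nat -> T -> 'cV[R]_m := fun _ _ => 0.

(** The observations of the uncontrolled system, which turn out to carry the same
    information as those under any admissible control. *)
Definition obs t : set (set T) := filt S no_control t.

Lemma sigma_algebra_obs t : sigma_algebra setT (obs t).
Proof. exact: filt_sigma_algebra. Qed.

Lemma obs_sub s t : (s <= t)%N -> obs s `<=` obs t.
Proof. exact: filt_sub. Qed.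

(** The response to the control alone, without noise and from the initial state
    0: the state is linear in the control. *)
Fixpoint forced u t om : 'cV[R]_n :=
  if t is t'.+1 then A S *m forced u t' om + B S *m u t' om else 0.

Lemma state_forced u t om : state S u t om = state S no_control t om + forced u t om.
Proof.
elim: t => [|t IH] /=; first by rewrite addr0.
rewrite IH /no_control mulmx0 addr0 mulmxDr -!addrA; congr (_ + _).
by rewrite addrA addrC.
Qed.

Lemma eq_forced u v t om : (forall s, (s < t)%N -> u s = v s) ->
  forced u t om = forced v t om.
Proof.
by elim: t => //= t IH h; rewrite IH ?h// => s st; rewrite h// ltnW.
Qed.

Lemma eq_state u v t : (forall s, (s < t)%N -> u s = v s) ->
  state S u t = state S v t.
Proof.
by move=> h; apply/funext => om; rewrite state_forced (eq_forced _ h) -state_forced.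
Qed.

Lemma forced_entrywise (F : (T -> R) -> Prop) u t :
  (forall c, F (fun=> c)) ->
  (forall f g, F f -> F g -> F (fun x => f x + g x)) ->
  (forall c f, F f -> F (fun x => c * f x)) ->
  (forall s, (s < t)%N -> entrywise F (u s)) -> entrywise F (forced u t).
Proof.
move=> Fc Fa Fs; elim: t => [|t IH] hu /=; first exact: entrywise_cst.
apply: entrywise_add => //; apply: entrywise_mull => //; last exact: hu.
by apply: IH => s st; apply: hu; exact: ltnW.
Qed.

Lemma forced_mfun G u t : sigma_algebra setT G ->
  (forall s, (s < t)%N -> entrywise (mfun_wrt G) (u s)) ->
  entrywise (mfun_wrt G) (forced u t).
Proof.
move=> sG; apply: forced_entrywise.
- by move=> c; exact: mfun_wrt_cst.
- by move=> f g; exact: mfun_wrtD.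
- by move=> c f; apply: mfun_wrtM => //; exact: mfun_wrt_cst.
Qed.

Lemma output_forced u t om :
  output S u t om = output S no_control t om + C S *m forced u t om.
Proof. by rewrite /output state_forced mulmxDr addrAC. Qed.

(** The outputs under u and under no control differ by C times the forced
    response, which is known to whoever knows the past controls; hence each
    output can be recovered from the other one, in both filtrations. *)
Lemma filt_obs u t : (forall s, (s < t)%N -> entrywise (mfun_wrt (obs s)) (u s)) ->
  filt S u t = obs t.
Proof.
move=> hu; have sO := sigma_algebra_obs t; have sF := filt_sigma_algebra u t.
have huO s : (s < t)%N -> entrywise (mfun_wrt (obs t)) (u s).
  by move=> st; apply: entrywise_sub_sigma (hu s st); apply: obs_sub; exact: ltnW.
apply/seteqP; split; apply: filt_min => // s st.
- rewrite (_ : output S u s = fun om => output S no_control s om + C S *m forced u s om).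
    apply: (mfun_entrywise_add sO); first exact: filt_output.
    apply: (mfun_entrywise_mull sO); apply: forced_mfun => // r rs.
    by apply: huO; exact: leq_trans rs st.
  by apply/funext => om; rewrite output_forced.
- rewrite (_ : output S no_control s = fun om => output S u s om - C S *m forced u s om).
    apply: (mfun_entrywise_sub sF); first exact: filt_output.
    apply: (mfun_entrywise_mull sF); apply: forced_mfun => // r rs.
    by apply: filt_input; exact: leq_trans rs st.
  by apply/funext => om; rewrite (output_forced u) addrK.
- exact: (mfun_entrywise_cst sF).
Qed.

Section measurable_system.
Hypothesis hx0 : mx_measurable measurable (x0 S).
Hypothesis hw : forall t, mx_measurable measurable (w S t).
Hypothesis heps : forall t, mx_measurable measurable (eps S t).
Hypothesis hx02 : square_integrable P (x0 S).
Hypothesis hw4 : forall t, ('E_P[fun om => (norm2 (w S t om) ^+ 4)%R] < +oo)%E.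

Lemma past_state u t :
  (forall s, (s < t)%N -> entrywise (mfun_wrt (past S t)) (u s)) ->
  entrywise (mfun_wrt (past S t)) (state S u t).
Proof.
move=> hu; have sP := (sub_sigma_past hx0 hw heps t).1.
rewrite (_ : state S u t = fun om => state S no_control t om + forced u t om); last first.
  by apply/funext => om; rewrite state_forced.
apply: (mfun_entrywise_add sP); last exact: forced_mfun.
suff : forall s, (s <= t)%N -> entrywise (mfun_wrt (past S t)) (state S no_control s).
  exact.
elim=> [_|s IH st] /=; first exact: past_x0.
apply: (mfun_entrywise_add sP); last by have [] := past_noise hx0 hw heps st.
apply: (mfun_entrywise_add sP); last first.
  by apply: (mfun_entrywise_mull sP); exact: (@mfun_entrywise_cst R T _ sP m 1 0).
by apply: (mfun_entrywise_mull sP); apply: IH; exact: ltnW.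
Qed.

Lemma obs_past t : obs t `<=` past S t.
Proof.
have sP := (sub_sigma_past hx0 hw heps t).1.
apply: filt_min => // s st; last exact: (@mfun_entrywise_cst R T _ sP m 1 0).
apply: (mfun_entrywise_add sP); last by have [] := past_noise hx0 hw heps st.
apply: (mfun_entrywise_mull sP).
apply: (entrywise_sub_sigma (G := past S s)); first exact: past_sub.
apply: past_state => r _.
exact: (@mfun_entrywise_cst R T _ (sub_sigma_past hx0 hw heps s).1 m 1 0).
Qed.

Lemma sub_sigma_obs t : sub_sigma (obs t).
Proof.
split; first exact: sigma_algebra_obs.
by apply: subset_trans (@obs_past t) _; exact: (sub_sigma_past hx0 hw heps t).2.
Qed.

(** Admissibility refers to the filtration of the control itself; by strong
    induction on time, that filtration is [obs]. *)
Lemma admissibleP N u : admissible S N u <->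
  forall t, (t < N)%N ->
    entrywise (mfun_wrt (obs t)) (u t) /\ entrywise (L2 P) (u t).
Proof.
have sqP t : entrywise (mfun_wrt (obs t)) (u t) ->
    square_integrable P (u t) <-> entrywise (L2 P) (u t).
  move=> h; apply: square_integrableP => i j.
  exact: (mfun_wrt_measurable (sub_sigma_obs t).2 (h i j)).
split=> [h|h t tN].
  have key t : (t < N)%N -> entrywise (mfun_wrt (obs t)) (u t).
    elim/ltn_ind: t => t IH tN; have [mu _] := h t tN.
    rewrite -(@filt_obs u t); last by move=> s st; apply: IH => //; exact: ltn_trans tN.
    by apply/mx_measurableP => //; exact: filt_sigma_algebra.
  by move=> t tN; split; [exact: key|apply/sqP; [exact: key|exact: (h t tN).2]].
have [mu Lu] := h t tN; split; last by apply/sqP.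
apply/mx_measurableP; first exact: filt_sigma_algebra.
by rewrite filt_obs// => s st; apply: (h s _).1; exact: ltn_trans tN.
Qed.

Lemma admissible_filt N u t : admissible S N u -> (t <= N)%N -> filt S u t = obs t.
Proof.
move=> /admissibleP h tN; apply: filt_obs => s st.
by apply: (h s _).1; exact: leq_trans tN.
Qed.

Lemma L2_state N u t : admissible S N u -> (t <= N)%N ->
  entrywise (L2 P) (state S u t).
Proof.
move=> /admissibleP h; elim: t => [_|t IH tN] /=.
  by apply/square_integrableP => //; apply/mx_measurable_entrywise.
apply: L2_entrywise_add; last exact: L2_w.
apply: L2_entrywise_add; apply: L2_entrywise_mull; first by apply: IH; exact: ltnW.
exact: (h t tN).2.
Qed.

End measurable_system.

End filtration.

(** * Estimation errors *)

Section estimation.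
Context {R : realType} {d : measure_display} {T : measurableType d}.
Context {P : probability T R} {n m q : nat} (S : lq_system P n m q).
Hypothesis hx0 : mx_measurable measurable (x0 S).
Hypothesis hw : forall t, mx_measurable measurable (w S t).
Hypothesis heps : forall t, mx_measurable measurable (eps S t).
Hypothesis hx02 : square_integrable P (x0 S).
Hypothesis hw4 : forall t, ('E_P[fun om => (norm2 (w S t om) ^+ 4)%R] < +oo)%E.
Implicit Types (u v : nat -> T -> 'cV[R]_m).

Let sO t : sub_sigma (obs S t) := sub_sigma_obs hx0 hw heps t.

Lemma admissible_no_control N : admissible S N (@no_control R d T m).
Proof.
apply/(admissibleP hx0 hw heps) => t _; split.
  exact: (@mfun_entrywise_cst R T _ (sO t).1 m 1 0).
exact: L2_entrywise_cst.
Qed.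

Section admissible_control.
Variables (N : nat) (u : nat -> T -> 'cV[R]_m).
Hypothesis hu : admissible S N u.

Let Lst t : (t <= N)%N -> entrywise (L2 P) (state S u t).
Proof. exact: (L2_state hx0 hw heps hx02 hw4 hu). Qed.

Let iL2 k l (X : T -> 'M[R]_(k, l)) :
  entrywise (L2 P) X -> entrywise (integrable1 P) X.
Proof. by move=> h i j; exact: L2_integrable (h i j). Qed.

Lemma mxce_xhat t s : (t <= N)%N -> (s <= N)%N ->
  mxce P (obs S s) (state S u t) (xhat S u t s).
Proof.
move=> tN sN; rewrite /xhat (admissible_filt hx0 hw heps hu sN).
by apply: mxce_cond_expect => //; apply: iL2; exact: Lst.
Qed.

Lemma L2_xhat t s : (t <= N)%N -> (s <= N)%N -> entrywise (L2 P) (xhat S u t s).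
Proof. by move=> tN sN; apply: (mxce_L2 (sO s) (Lst tN)); exact: mxce_xhat. Qed.

Lemma mfun_xhat t s : (t <= N)%N -> (s <= N)%N ->
  entrywise (mfun_wrt (obs S s)) (xhat S u t s).
Proof. by move=> tN sN; exact: mxce_mfun (mxce_xhat tN sN). Qed.

Lemma L2_est_err t : (t <= N)%N -> entrywise (L2 P) (est_err S u t).
Proof. by move=> tN; apply: L2_entrywise_sub; [exact: Lst|exact: L2_xhat]. Qed.

Lemma mxce_est_err t : (t <= N)%N ->
  mxce P (obs S t) (est_err S u t) (fun=> 0).
Proof.
move=> tN; have cx := mxce_xhat tN tN.
have := mxceB (sO t) cx (mxce_self (mfun_xhat tN tN) (iL2 (L2_xhat tN tN))).
by congr mxce; apply/funext => om; rewrite subrr.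
Qed.

(** Separation: the forced response is observable, hence estimated without
    error, and cancels in the estimation error. *)
Lemma est_err_no_control t : (t <= N)%N ->
  {ae P, forall om, est_err S u t om = est_err S (@no_control R d T m) t om}.
Proof.
move=> tN; have [hu' h0] := (hu, @admissible_no_control N).
have /(admissibleP hx0 hw heps) au := hu'.
have mf : entrywise (mfun_wrt (obs S t)) (forced S u t).
  apply: forced_mfun => [|s st]; first exact: (sO t).1.
  apply: (entrywise_sub_sigma (G := obs S s)); first by apply: obs_sub; exact: ltnW.
  by apply: (au s _).1; exact: leq_trans tN.
have lf : entrywise (L2 P) (forced S u t).
  apply: forced_entrywise => [c|f g|c f|s st]; [exact: L2_cst|exact: L2D|exact: L2Z|].
  by apply: (au s _).2; exact: leq_trans tN.
have c0 : mxce P (obs S t) (state S (@no_control R d T m) t) (xhat S (@no_control R d T m) t t).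
  rewrite /xhat; apply: mxce_cond_expect; first exact: sO.
  by apply: iL2; exact: (L2_state hx0 hw heps hx02 hw4 h0).
have := mxce_ae_uniq (sO t) (mxce_xhat tN tN)
  (mxceD (sO t) c0 (mxce_self mf (iL2 lf))) (aeW _ (state_forced S u t)).
apply: filterS => om xE.
by rewrite /est_err xE (state_forced S u) opprD addrACA subrr addr0.
Qed.

Lemma xhat_no_control t : (t <= N)%N ->
  {ae P, forall om, xhat S u t t om =
    xhat S (@no_control R d T m) t t om + forced S u t om}.
Proof.
move=> tN; apply: filterS (est_err_no_control tN) => om.
rewrite /est_err (state_forced S u) => /(congr1 (fun z => - z)).
rewrite !opprB => /(canRL (subrK _)) ->.
by rewrite addrA subrK.
Qed.

Lemma mxce_Sigma t : (t <= N)%N ->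
  mxce P (obs S t) (fun om => est_err S u t om *m (est_err S u t om)^T) (Sigma S u t).
Proof.
move=> tN; rewrite /Sigma (admissible_filt hx0 hw heps hu tN).
apply: mxce_cond_expect; first exact: sO.
by apply: integrable_outer; exact: L2_est_err.
Qed.

Lemma ce_qform_est_err (M : 'M[R]_n) t : (t <= N)%N ->
  ce P (obs S t) (fun om => qform M (est_err S u t om)) (fun om => \tr (M *m Sigma S u t om)).
Proof.
move=> tN; have := mxce_trace (sO t) (mxce_mull (sO t) M (mxce_Sigma tN)).
by congr ce; apply/funext => om; rewrite qform_tr.
Qed.

(** This is where the matrix [Hpred] comes from: the prediction error is
    e_t + b with b the change of the estimate at time t. As b is known at time
    t and e_t has conditional mean 0, E[e_t b^T | F_{t-1}] = 0, so
    H_{t|t-1} = E[e_t e_t^T | F_{t-1}]. *)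
Lemma ce_qform_est_err_pred (M : 'M[R]_n) t : (t < N)%N ->
  ce P (obs S t) (fun om => qform M (est_err S u t.+1 om))
    (fun om => \tr (M *m Hpred S u t.+1 om)).
Proof.
move=> tN; have tN' := ltnW tN.
pose b om := xhat S u t.+1 t.+1 om - xhat S u t.+1 t om.
have oS := @obs_sub R d T P n m q S _ _ (leqnSn t).
have mb : entrywise (mfun_wrt (obs S t.+1)) b.
  apply: (mfun_entrywise_sub (sO t.+1).1); first exact: mfun_xhat.
  by apply: (entrywise_sub_sigma oS); exact: mfun_xhat.
have lb : entrywise (L2 P) b by apply: L2_entrywise_sub; exact: L2_xhat.
have le := L2_est_err tN.
have cb : ce P (obs S t) (fun om => dotv (b om) (M *m est_err S u t.+1 om)) (fun=> 0).
  apply: (ce_tower oS _ (ce_cst P 0 (sO t).1)).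
  have := mxce_dotv (sO t.+1) (L2_entrywise_mull M le) lb mb
    (mxce_mull (sO t.+1) M (mxce_est_err tN)).
  by congr ce; apply/funext => om; rewrite mulmx0 /dotv mulmx0 mxE.
have cH : mxce P (obs S t) (fun om => est_err S u t.+1 om *m (pred_err S u t.+1 om)^T)
    (Hpred S u t.+1).
  rewrite /Hpred /= (admissible_filt hx0 hw heps hu tN').
  apply: mxce_cond_expect; first exact: sO.
  apply: integrable_outer => //; apply: L2_entrywise_sub; first exact: Lst.
  exact: L2_xhat.
have := ceB (sO t) (mxce_trace (sO t) (mxce_mull (sO t) M cH)) cb.
congr ce; apply/funext => om; last by rewrite subr0.
have -> : pred_err S u t.+1 om = est_err S u t.+1 om + b om.
  by rewrite /pred_err /est_err /b addrA subrK.
rewrite linearD/= mulmxDr mulmxDr linearD/= qform_tr.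
have -> : \tr (M *m (est_err S u t.+1 om *m (b om)^T)) =
    dotv (b om) (M *m est_err S u t.+1 om).
  by rewrite mulmxA mxtrace_mulC trace_mx11.
by rewrite addrK.
Qed.

End admissible_control.

(** A known vector X and an error E of conditional mean 0 are orthogonal. *)
Lemma ce_qform_cross G k (M : 'M[R]_k) (X E : T -> 'cV[R]_k) : sub_sigma G -> M^T = M ->
  entrywise (L2 P) X -> entrywise (mfun_wrt G) X ->
  entrywise (L2 P) E -> mxce P G E (fun=> 0) ->
  ce P G (fun om => qform M (X om + E om) - qform M (X om) - qform M (E om)) (fun=> 0).
Proof.
move=> sG sM LX mX LE cE.
have := ceZ 2 sG (mxce_dotv sG (L2_entrywise_mull M LE) LX mX (mxce_mull sG M cE)).
congr ce; apply/funext => om; last by rewrite mulmx0 /dotv mulmx0 mxE mulr0.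
by rewrite qformD//; ring.
Qed.

End estimation.

(** * The value function and the completed square *)

Lemma downward_ind (N : nat) (Q : nat -> Prop) : Q N ->
  (forall t, (t < N)%N -> Q t.+1 -> Q t) -> forall t, (t <= N)%N -> Q t.
Proof.
move=> QN step t tN; rewrite -(subKn tN).
elim: (N - t)%N (leq_subr t N) => [_|j IH jN]; first by rewrite subn0.
apply: step; first by rewrite -subSn// subSS leq_subr.
by rewrite -subSn// subSS; apply: IH; exact: ltnW.
Qed.

Section control.
Context {R : realType} {d : measure_display} {T : measurableType d}.
Context {P : probability T R} {n m q : nat} (S : lq_system P n m q).
Variables (mus muo : R) (N : nat).
Variables (V Tm Sm : nat -> 'M[R]_n) (K : nat -> 'M[R]_(m, n)) (h l : nat -> 'cV[R]_m).
Hypothesis hQmu : possemidef (Qmu S mus muo).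
Hypothesis hR : posdef (Ru S).
Hypothesis hVN : V N = Qmu S mus muo.
Hypothesis hSN : Sm N = 1%:M.
Hypothesis hTN : Tm N = 0.
Hypothesis hK : forall t, (1 <= t <= N)%N ->
   K t.-1 = - (invmx ((B S)^T *m V t *m B S + Ru S) *m (B S)^T *m V t *m A S).
Hypothesis hh : forall t, (1 <= t <= N)%N ->
   h t.-1 = - (invmx ((B S)^T *m V t *m B S + Ru S)
               *m (B S)^T *m (V t + Tm t) *m wbar S).
Hypothesis hl : forall t, (1 <= t <= N)%N ->
   l t.-1 = - (2^-1 *: (invmx ((B S)^T *m V t *m B S + Ru S)
                        *m (B S)^T *m Sm t *m Mmu S mus muo)).
Hypothesis hV : forall t, (1 <= t <= N)%N ->
   V t.-1 = (A S)^T *m V t *m A S + Qmu S mus muo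
            - (A S)^T *m V t *m B S
              *m invmx ((B S)^T *m V t *m B S + Ru S)
              *m (B S)^T *m V t *m A S.
Hypothesis hT : forall t, (1 <= t <= N)%N ->
   Tm t.-1 = (A S + B S *m K t.-1)^T *m (V t + Tm t).
Hypothesis hS : forall t, (1 <= t <= N)%N ->
   Sm t.-1 = (A S + B S *m K t.-1)^T *m Sm t + 1%:M.

Definition input_weight t : 'M[R]_m := (B S)^T *m V t.+1 *m B S + Ru S.

(** Half the linear coefficient of the value function, which collects the
    contributions of [Tm] and [Sm]. *)
Definition lin_coef t : 'cV[R]_n := Tm t *m wbar S + 2^-1 *: (Sm t *m Mmu S mus muo).

Definition value t (x : 'cV[R]_n) : R := qform (V t) x + 2 * dotv x (lin_coef t).

Definition step_const t : R :=
  qform (V t.+1) (wbar S) + 2 * dotv (wbar S) (lin_coef t.+1)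
  - qform (input_weight t) (h t + l t).

(** The gains solve the normal equations of [complete_square], and V t has the
    shape that it asks for. *)
Lemma Riccati_step t : (t < N)%N -> possemidef (V t.+1) ->
  [/\ posdef (input_weight t),
      input_weight t *m K t = - ((B S)^T *m V t.+1 *m A S),
      input_weight t *m (h t + l t) =
        - ((B S)^T *m (V t.+1 *m wbar S + lin_coef t.+1)) &
      V t = (A S)^T *m V t.+1 *m A S + Qmu S mus muo
            - (K t)^T *m input_weight t *m K t].
Proof.
move=> tN pV; have t1N : (1 <= t.+1 <= N)%N by [].
have pG : posdef (input_weight t) by apply: posdefD => //; exact: possemidef_congr.
have uG := posdef_unitmx pG.
have GK : input_weight t *m K t = - ((B S)^T *m V t.+1 *m A S).
  by rewrite (hK t1N) -/(input_weight t) mulmxN -!mulmxA (mulKVmx uG).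
split=> //.
  rewrite (hh t1N) (hl t1N) -/(input_weight t) [LHS]mulmxDr !mulmxN -scalemxAr -!mulmxA !(mulKVmx uG).
  by rewrite -opprD scalemxAr -mulmxDr /lin_coef mulmxDl addrA.
rewrite (hV t1N) -/(input_weight t) -(mulmxA (K t)^T) GK (hK t1N) -/(input_weight t) mulmxN; congr (_ - _).
rewrite linearN/= mulNmx opprK !trmx_mul trmx_inv trmxK !mulmxA.
by rewrite pV.1 pG.1 /input_weight.
Qed.

Lemma lin_coef_step t : (t < N)%N ->
  2 *: lin_coef t = 2 *: ((A S + B S *m K t)^T *m (V t.+1 *m wbar S + lin_coef t.+1))
    + Mmu S mus muo.
Proof.
move=> tN; have t1N : (1 <= t.+1 <= N)%N by [].
have lE s : 2 *: lin_coef s = 2 *: (Tm s *m wbar S) + Sm s *m Mmu S mus muo.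
  by rewrite scalerDr scalerA mulfV ?pnatr_eq0// scale1r.
rewrite lE (hT t1N) (hS t1N) mulmxDl mul1mx addrA; congr (_ + _).
set F := (A S + B S *m K t)^T.
rewrite [in RHS]mulmxDr [in RHS]scalerDr (scalemxAr 2 _ (lin_coef _)) lE.
rewrite [in RHS]mulmxDr -[in RHS]scalemxAr addrA -scalerDr -[in RHS]mulmxDr -mulmxDl.
by rewrite !mulmxA.
Qed.

Lemma value_terminal x : value N x = terminal_cost S mus muo x.
Proof.
rewrite /value /terminal_cost hVN /lin_coef hTN hSN mul0mx add0r mul1mx dotvZr.
by rewrite mulrA mulfV ?pnatr_eq0// mul1r.
Qed.

Lemma value_step t (x dl : 'cV[R]_n) (u : 'cV[R]_m) : (t < N)%N -> possemidef (V t.+1) ->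
  value t.+1 (A S *m x + B S *m u + (wbar S + dl)) + stage_cost S mus muo x u
  = value t x + qform (input_weight t) (u - (K t *m x + (h t + l t))) + step_const t
    + (2 * dotv dl (V t.+1 *m (A S *m x + B S *m u) + V t.+1 *m wbar S + lin_coef t.+1)
       + qform (V t.+1) dl).
Proof.
move=> tN pV; have [pG GK Gh VE] := Riccati_step tN pV.
rewrite /value /stage_cost /step_const.
rewrite (complete_square u x dl pV.1 hR.1 GK Gh VE (lin_coef_step tN)) -/(input_weight t).
by rewrite -!addrA.
Qed.

(** In the completed square with u = K x and all affine terms 0, x^T (V t) x is a
    sum of costs. *)
Lemma possemidef_V t : (t <= N)%N -> possemidef (V t).
Proof.
move: t; apply: downward_ind => [|t tN pV]; first by rewrite hVN.
have [pG GK _ VE] := Riccati_step tN pV.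
split.
  by rewrite VE linearB/= linearD/= !trmx_mul !trmxK pV.1 pG.1 hQmu.1 !mulmxA.
move=> x.
have := @complete_square R n m (A S) (V t.+1) (Qmu S mus muo) (V t) (B S) (Ru S) (K t)
  0 (K t *m x) 0 0 0 0 x 0 pV.1 hR.1 GK.
rewrite !(mulmx0, addr0, oppr0) => /(_ erefl VE).
rewrite scaler0 => /(_ erefl).
have d0 (y : 'cV[R]_n) : dotv y 0 = 0 by rewrite /dotv mulmx0 mxE.
have q0 k (W : 'M[R]_k) : qform W 0 = 0 by rewrite /qform mulmx0 mxE.
rewrite subrr !q0 (dotvC 0) !d0 !(mulr0, addr0, subr0) => <-.
by rewrite !addr_ge0 ?pV.2 ?hQmu.2 ?(posdef_possemidef hR).2.
Qed.

Lemma posdef_input_weight t : (t < N)%N -> posdef (input_weight t).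
Proof. by move=> tN; have [] := Riccati_step tN (possemidef_V tN). Qed.

Hypothesis hx0 : mx_measurable measurable (x0 S).
Hypothesis hw : forall t, mx_measurable measurable (w S t).
Hypothesis heps : forall t, mx_measurable measurable (eps S t).
Hypothesis hindep : mutually_independent P (source_sigma S).
Hypothesis hid : identically_distributed P
  (fun (t : nat) (om : T) => col_mx (w S t om) (eps S t om)).
Hypothesis hx02 : square_integrable P (x0 S).
Hypothesis hw4 : forall t, ('E_P[fun om => (norm2 (w S t om) ^+ 4)%R] < +oo)%E.
Implicit Types (u v : nat -> T -> 'cV[R]_m).

Let sO t : sub_sigma (obs S t) := sub_sigma_obs hx0 hw heps t.
Let sP t : sub_sigma (past S t) := sub_sigma_past hx0 hw heps t.

(** How far the control is from the candidate optimal law. *)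
Definition deviation u t om : 'cV[R]_m :=
  u t om - (K t *m xhat S u t t om + (h t + l t)).

(** The part of a step that involves the next noise. *)
Definition noise_term u t om : R :=
  let dl := w S t.+1 om - wbar S in
  2 * dotv dl (V t.+1 *m (A S *m state S u t om + B S *m u t om)
               + V t.+1 *m wbar S + lin_coef t.+1)
  + qform (V t.+1) dl.

(** The steps of [value_step] telescope from time k to the horizon. *)
Lemma tail_costE u k om : (k <= N)%N ->
  tail_cost S mus muo N k u om = value k (state S u k om)
    + \sum_(k <= t < N) (qform (input_weight t)
         (u t om - (K t *m state S u t om + (h t + l t)))
       + step_const t + noise_term u t om).
Proof.
move: k; apply: downward_ind => [|k kN IH].
  by rewrite /tail_cost !big_geq// !addr0 value_terminal.
rewrite /tail_cost big_ltn// addrCA -/(tail_cost S mus muo N k.+1 u om) IH.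
rewrite [in RHS]big_ltn// [LHS]addrA [RHS]addrA; congr (_ + _).
have -> : state S u k.+1 om
    = A S *m state S u k om + B S *m u k om + (wbar S + (w S k.+1 om - wbar S)).
  by rewrite /= [wbar S + _]addrC subrK.
by rewrite [LHS]addrC (value_step _ _ _ kN (possemidef_V kN)) [RHS]addrA (addrA (value k _)).
Qed.

(** What remains of the cost when the control follows the candidate law: the
    estimation errors and the noise. It does not depend on the control, and p k
    is its conditional expectation. *)
Definition error_cost u k om : R :=
  qform (V k) (est_err S u k om)
  + \sum_(k <= t < N) (step_const t + \tr (V t.+1 *m covW S)
                       + qform (input_weight t) (K t *m est_err S u t om)).

Definition control_cost u k om : R :=
  \sum_(k <= t < N) qform (input_weight t) (deviation u t om).

Section admissible_control.
Variable u : nat -> T -> 'cV[R]_m.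
Hypothesis hu : admissible S N u.

Let u_obs t : (t < N)%N -> entrywise (mfun_wrt (obs S t)) (u t).
Proof. by move: hu => /(admissibleP hx0 hw heps) a tN; exact: (a t tN).1. Qed.

Let u_L2 t : (t < N)%N -> entrywise (L2 P) (u t).
Proof. by move: hu => /(admissibleP hx0 hw heps) a tN; exact: (a t tN).2. Qed.

Lemma deviation_obs t : (t < N)%N ->
  entrywise (mfun_wrt (obs S t)) (deviation u t).
Proof.
move=> tN; have sG := (sO t).1; have tN' := ltnW tN.
apply: (mfun_entrywise_sub sG); first exact: u_obs.
apply: (mfun_entrywise_add sG); last exact: (@mfun_entrywise_cst R T _ sG m 1).
by apply: (mfun_entrywise_mull sG); exact: (mfun_xhat hx0 hw heps hx02 hw4 hu).
Qed.

Lemma deviation_L2 t : (t < N)%N -> entrywise (L2 P) (deviation u t).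
Proof.
move=> tN; have tN' := ltnW tN.
apply: L2_entrywise_sub; first exact: u_L2.
apply: L2_entrywise_add; last exact: L2_entrywise_cst.
by apply: L2_entrywise_mull; exact: (L2_xhat hx0 hw heps hx02 hw4 hu).
Qed.

Lemma integrable_control_cost k : integrable1 P (control_cost u k).
Proof.
have -> : control_cost u k = fun om => \sum_(k <= t < N)
    (if (t < N)%N then qform (input_weight t) (deviation u t om) else 0).
  by apply/funext => om; apply: eq_big_nat => t /andP[_ ->].
apply: integrable1_sum => t; case: ltnP => tN; last exact: integrable1_cst.
by apply: integrable_qform; exact: deviation_L2.
Qed.

(** The next noise is centred and has covariance [covW] given the past, which
    determines the state and the control. *)
Lemma ce_noise_term t : (t < N)%N ->
  ce P (past S t) (fun om => noise_term u t om - \tr (V t.+1 *m covW S)) (fun=> 0).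
Proof.
move=> tN; have sG := (sP t).1.
have cd := mxce_next_noise hx0 hw heps hindep hid hw4 t.
have cdd := mxce_next_noise_outer hx0 hw heps hindep hid hw4 t.
have mP := entrywise_sub_sigma (@obs_past _ _ _ _ _ _ _ S hx0 hw heps t).
pose b om := V t.+1 *m (A S *m state S u t om + B S *m u t om)
  + V t.+1 *m wbar S + lin_coef t.+1.
have mb : entrywise (mfun_wrt (past S t)) b.
  apply: (mfun_entrywise_add sG); last exact: (@mfun_entrywise_cst R T _ sG n 1).
  apply: (mfun_entrywise_add sG); last exact: (@mfun_entrywise_cst R T _ sG n 1).
  apply: (mfun_entrywise_mull sG).
  apply: (mfun_entrywise_add sG); apply: (mfun_entrywise_mull sG).
    apply: (past_state hx0 hw heps) => s st.
    apply: mP; apply: (entrywise_sub_sigma (G := obs S s)); first by apply: obs_sub; exact: ltnW.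
    by apply: u_obs; exact: ltn_trans tN.
  by apply: mP; exact: u_obs.
have lb : entrywise (L2 P) b.
  apply: L2_entrywise_add; last exact: L2_entrywise_cst.
  apply: L2_entrywise_add; last exact: L2_entrywise_cst.
  apply: L2_entrywise_mull; apply: L2_entrywise_add; apply: L2_entrywise_mull.
    by apply: (L2_state hx0 hw heps hx02 hw4 hu); exact: ltnW.
  exact: u_L2.
have ld : entrywise (L2 P) (fun om => w S t.+1 om - wbar S).
  by apply: L2_entrywise_sub; [exact: L2_w|exact: L2_entrywise_cst].
have c1 := ceZ 2 (sP t) (mxce_dotv (sP t) ld lb mb cd).
have c2 := mxce_trace (sP t) (mxce_mull (sP t) (V t.+1) cdd).
have c3 := ceB (sP t) (ceD (sP t) c1 c2) (ce_cst P (\tr (V t.+1 *m covW S)) sG).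
move: c3; congr ce; apply/funext => om.
  by rewrite /noise_term -/(b om) qform_tr dotvC.
by rewrite /dotv mulmx0 mxE mulr0 add0r subrr.
Qed.

(** The cost-to-go splits, up to terms of conditional mean 0, into the value of
    the estimate, the error cost and the control cost. The true state enters
    [tail_costE] through u - (K x + h + l) = deviation - K e, and the cross
    terms between what is known and the estimation error e average out, as do
    the noise terms. *)
Lemma ce_tail_cost k : (k <= N)%N ->
  ce P (obs S k) (fun om => tail_cost S mus muo N k u om - control_cost u k om
    - value k (xhat S u k k om) - error_cost u k om) (fun=> 0).
Proof.
move=> kN.
have tower G (X : T -> R) : obs S k `<=` G -> ce P G X (fun=> 0) ->
    ce P (obs S k) X (fun=> 0).
  by move=> kG cX; exact: (ce_tower kG cX (ce_cst P 0 (sO k).1)).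
have LX t : (t <= N)%N -> entrywise (L2 P) (xhat S u t t).
  by move=> tN; exact: (L2_xhat hx0 hw heps hx02 hw4 hu).
have mX t : (t <= N)%N -> entrywise (mfun_wrt (obs S t)) (xhat S u t t).
  by move=> tN; exact: (mfun_xhat hx0 hw heps hx02 hw4 hu).
have LE t : (t <= N)%N -> entrywise (L2 P) (est_err S u t).
  by move=> tN; exact: (L2_est_err hx0 hw heps hx02 hw4 hu).
have cE t : (t <= N)%N -> mxce P (obs S t) (est_err S u t) (fun=> 0).
  by move=> tN; exact: (mxce_est_err hx0 hw heps hx02 hw4 hu).
have cinit := ce_qform_cross (sO k) (possemidef_V kN).1
  (LX k kN) (mX k kN) (LE k kN) (cE k kN).
have clin := ceZ 2 (sO k) (mxce_dotv (sO k) (LE k kN) (L2_entrywise_cst P (lin_coef k))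
  (@mfun_entrywise_cst R T _ (sO k).1 n 1 (lin_coef k)) (cE k kN)).
pose F t om := qform (input_weight t) (deviation u t om + (- K t) *m est_err S u t om)
   - qform (input_weight t) (deviation u t om)
   - qform (input_weight t) ((- K t) *m est_err S u t om)
   + (noise_term u t om - \tr (V t.+1 *m covW S)).
have csum : ce P (obs S k) (fun om => \sum_(k <= t < N) F t om)
    (fun om => \sum_(k <= t < N) 0).
  apply: ce_sum_in => // t; rewrite mem_index_iota => /andP[kt tN].
  have ot := @obs_sub R d T P n m q S _ _ kt.
  have sG := posdef_possemidef (posdef_input_weight tN).
  have tN' := ltnW tN.
  have cK : mxce P (obs S t) (fun om => (- K t) *m est_err S u t om) (fun=> 0).
    by have := mxce_mull (sO t) (- K t) (cE t tN'); rewrite mulmx0.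
  have c1 := ce_qform_cross (sO t) sG.1 (deviation_L2 tN) (deviation_obs tN)
    (L2_entrywise_mull (- K t) (LE t tN')) cK.
  have c2 := tower _ _ (subset_trans ot (@obs_past _ _ _ _ _ _ _ S hx0 hw heps t)) (ce_noise_term tN).
  have := ceD (sO k) (tower _ _ ot c1) c2.
  by rewrite addr0.
have := ceD (sO k) (ceD (sO k) cinit clin) csum.
congr ce; apply/funext => om; last first.
  by rewrite big1// /dotv mulmx0 mxE mulr0 !addr0.
rewrite tail_costE// /value /error_cost /control_cost.
have xE t : state S u t om = xhat S u t t om + est_err S u t om.
  by rewrite /est_err addrC subrK.
have -> : \sum_(k <= t < N) F t om =
  \sum_(k <= t < N) (qform (input_weight t)
         (u t om - (K t *m state S u t om + (h t + l t)))
       + step_const t + noise_term u t om)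
  - \sum_(k <= t < N) qform (input_weight t) (deviation u t om)
  - \sum_(k <= t < N) (step_const t + \tr (V t.+1 *m covW S)
                       + qform (input_weight t) (K t *m est_err S u t om)).
  rewrite -!sumrB; apply: eq_bigr => t _.
  rewrite /F mulNmx qformN.
  have -> : deviation u t om - K t *m est_err S u t om
      = u t om - (K t *m state S u t om + (h t + l t)).
    rewrite /deviation xE [in RHS]mulmxDr (addrAC (K t *m _)).
    by rewrite [in RHS]opprD [in RHS]addrA.
  by ring.
rewrite xE dotvDl (dotvC (lin_coef k)).
by ring.
Qed.

Lemma integrable_error_cost k : (k <= N)%N -> integrable1 P (error_cost u k).
Proof.
move=> kN; have LE t : (t <= N)%N -> entrywise (L2 P) (est_err S u t).
  by move=> tN; exact: (L2_est_err hx0 hw heps hx02 hw4 hu).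
apply: integrable1D; first by apply: integrable_qform; exact: LE.
have -> : (fun om => \sum_(k <= t < N) (step_const t + \tr (V t.+1 *m covW S)
       + qform (input_weight t) (K t *m est_err S u t om))) =
  (fun om => \sum_(k <= t < N) (if (t < N)%N then step_const t + \tr (V t.+1 *m covW S)
       + qform (input_weight t) (K t *m est_err S u t om) else 0)).
  by apply/funext => om; apply: eq_big_nat => t /andP[_ ->].
apply: integrable1_sum => t; case: ltnP => tN; last exact: integrable1_cst.
apply: integrable1D; first exact: integrable1_cst.
by apply: integrable_qform; apply: L2_entrywise_mull; apply: LE; exact: ltnW.
Qed.

Lemma error_cost_no_control k : (k <= N)%N ->
  {ae P, forall om, error_cost u k om = error_cost (@no_control R d T m) k om}.
Proof.
move=> kN.
have : {ae P, forall om, forall t, (t <= N)%N ->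
    est_err S u t om = est_err S (@no_control R d T m) t om}.
  apply: ae_foralln => t; case: (leqP t N) => tN.
    apply: filterS (est_err_no_control hx0 hw heps hx02 hw4 hu tN) => om eE _.
    exact: eE.
  by apply: aeW => om.
apply: filterS => om eE; rewrite /error_cost eE//; congr (_ + _).
by apply: eq_big_nat => t /andP[_ tN]; rewrite eE// ltnW.
Qed.

Lemma integrable_value k : (k <= N)%N ->
  integrable1 P (fun om => value k (xhat S u k k om)).
Proof.
move=> kN; have LX := L2_xhat hx0 hw heps hx02 hw4 hu kN kN.
apply: integrable1D; first exact: integrable_qform.
by apply: integrable1Z; apply: integrable_dotv => //; exact: L2_entrywise_cst.
Qed.

Lemma mfun_value k : (k <= N)%N ->
  mfun_wrt (obs S k) (fun om => value k (xhat S u k k om)).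
Proof.
move=> kN; have sG := (sO k).1; have mX := mfun_xhat hx0 hw heps hx02 hw4 hu kN kN.
apply: (mfun_wrtD sG); first exact: mfun_qform.
apply: (mfun_wrtM sG); first exact: mfun_wrt_cst.
by apply: (mfun_dotv sG) => //; exact: (@mfun_entrywise_cst R T _ sG n 1).
Qed.

Lemma integrable_tail_cost k : (k <= N)%N ->
  integrable1 P (tail_cost S mus muo N k u).
Proof.
move=> kN; have [i0 _] := ce_tail_cost kN.
have := integrable1D (integrable1D i0 (integrable_control_cost k))
  (integrable1D (integrable_value kN) (integrable_error_cost kN)).
by congr (integrable1 P _); apply/funext => om; ring.
Qed.

(** Backward induction on time. The recursion for p holds because
    A^T V A + Q_mu = V_{t-1} + K^T G K, so the two error terms at time t-1
    combine; the term at time t that E[p_t | F_{t-1}] counts and error cost at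
    t-1 does not is E[e_t^T V_t e_t | F_{t-1}] = tr (V_t H_{t|t-1}). In the
    recursion it appears once with a plus sign, inside the conditional
    expectation and written with Sigma, and twice with a minus sign. *)
Lemma ce_error_cost (p : nat -> T -> R) :
  p N = (fun om => \tr (Qmu S mus muo *m Sigma S u N om)) ->
  (forall t, (1 <= t <= N)%N ->
     p t.-1 = offset_step S mus muo (V t) (Tm t) (Sm t) (h t.-1 + l t.-1) u t (p t)) ->
  forall k, (k <= N)%N -> ce P (obs S k) (error_cost u k) (p k).
Proof.
move=> pN pstep; apply: downward_ind => [|k kN cp].
  rewrite pN -hVN.
  have := ce_qform_est_err hx0 hw heps hx02 hw4 hu (V N) (leqnn N).
  by congr ce; apply/funext => om; rewrite /error_cost big_geq// addr0.
have kN' := ltnW kN; have oS := @obs_sub R d T P n m q S _ _ (leqnSn k).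
have [pG _ _ VE] := Riccati_step kN (possemidef_V kN).
rewrite (pstep k.+1 kN) /offset_step /=.
rewrite (admissible_filt hx0 hw heps hu kN').
have cQ (M : 'M[R]_n) := ce_qform_est_err hx0 hw heps hx02 hw4 hu M.
have c1 := ceD (sO k.+1) cp (cQ (V k.+1) _ kN).
have c2 : ce P (obs S k) (fun om => error_cost u k.+1 om + qform (V k.+1) (est_err S u k.+1 om))
    (cond_expect P (obs S k) (fun om => p k.+1 om + \tr (V k.+1 *m Sigma S u k.+1 om))).
  by apply: (ce_tower oS c1); apply: ce_cond_expect => //; exact: ce_integrable c1.
have c3 := ceZ 2 (sO k) (ce_qform_est_err_pred hx0 hw heps hx02 hw4 hu (V k.+1) kN).
have c4 := cQ (Qmu S mus muo) _ kN'.
have c5 := cQ ((A S)^T *m V k.+1 *m A S) _ kN'.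
have c6 := ce_cst P (step_const k + \tr (V k.+1 *m covW S)) (sO k).1.
have := ceD (sO k) (ceD (sO k) (ceD (sO k) (ceB (sO k) c2 c3) c4) c5) c6.
congr ce; apply/funext => om.
  rewrite /error_cost [in RHS]big_ltn//.
  have -> : qform (V k) (est_err S u k om) =
      qform ((A S)^T *m V k.+1 *m A S) (est_err S u k om)
      + qform (Qmu S mus muo) (est_err S u k om)
      - qform (input_weight k) (K k *m est_err S u k om).
    by rewrite VE -qform_congr -!qformDm -[in RHS]mulN1r -qformZm -qformDm scaleN1r.
  by ring.
rewrite /step_const -/(input_weight k).
have -> : qform (V k.+1 + 2 *: Tm k.+1) (wbar S) = qform (V k.+1) (wbar S)
   + 2 * dotv (wbar S) (lin_coef k.+1) - dotv (wbar S) (Sm k.+1 *m Mmu S mus muo).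
  rewrite qformDm qformZm (qform_dotv (Tm _)) /lin_coef dotvDr dotvZr.
  by rewrite mulrDr mulrA mulfV ?pnatr_eq0// mul1r addrA addrK.
(* over plain reals: comparing the matrix expressions by conversion is slow *)
have ringE (c0 c3' c4' c5' e f g i t : R) :
    c0 - 2 * c3' + c4' + c5' + (e + 2 * f - g + t) =
    c0 - g + (e + 2 * f - i) + i + c4' - 2 * c3' + c5' + t by ring.
exact: ringE.
Qed.

End admissible_control.

Lemma admissible_xhat u v k : admissible S N u -> admissible S N v -> (k <= N)%N ->
  (forall s, (s < k)%N -> v s = u s) -> xhat S v k k = xhat S u k k.
Proof.
move=> hu hv kN vu; rewrite /xhat (eq_state S vu).
by rewrite (admissible_filt hx0 hw heps hv kN) (admissible_filt hx0 hw heps hu kN).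
Qed.

(** * Optimality of the feedback law *)

Section feedback.
Variables (u : nat -> T -> 'cV[R]_m) (k : nat).
Hypothesis hu : admissible S N u.

Let m0 t := xhat S (@no_control R d T m) t t.

(** The forced response when the control follows u before time k and the law
    K xhat + h + l from then on. The estimate is written as the estimate [m0] of
    the uncontrolled state plus the forced response: referring to the estimate
    under the control being defined would be circular. *)
Fixpoint closed_loop t om : 'cV[R]_n :=
  if t is t'.+1 then
    A S *m closed_loop t' om
    + B S *m (if (t' < k)%N then u t' om
              else K t' *m (m0 t' om + closed_loop t' om) + (h t' + l t'))
  else 0.

Definition feedback t om : 'cV[R]_m :=
  if (t < k)%N then u t om else K t *m (m0 t om + closed_loop t om) + (h t + l t).

Lemma forced_feedback t om : forced S feedback t om = closed_loop t om.
Proof. by elim: t => //= t ->. Qed.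

Lemma feedback_admissible : admissible S N feedback.
Proof.
have h0 := @admissible_no_control R d T P n m q S hx0 hw heps N.
have /(admissibleP hx0 hw heps) au := hu.
have fb t : (t < N)%N ->
    entrywise (mfun_wrt (obs S t)) (closed_loop t) -> entrywise (L2 P) (closed_loop t) ->
    entrywise (mfun_wrt (obs S t)) (feedback t) /\ entrywise (L2 P) (feedback t).
  move=> tN mc lc; have sG := (sO t).1; rewrite /feedback.
  case: ltnP => _; first exact: au.
  split.
    apply: (mfun_entrywise_add sG); last exact: (@mfun_entrywise_cst R T _ sG m 1).
    apply: (mfun_entrywise_mull sG); apply: (mfun_entrywise_add sG) => //.
    by apply: (mfun_xhat hx0 hw heps hx02 hw4 h0); exact: ltnW.
  apply: L2_entrywise_add; last exact: L2_entrywise_cst.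
  apply: L2_entrywise_mull; apply: L2_entrywise_add => //.
  by apply: (L2_xhat hx0 hw heps hx02 hw4 h0); exact: ltnW.
have cl t : (t <= N)%N ->
    entrywise (mfun_wrt (obs S t)) (closed_loop t) /\ entrywise (L2 P) (closed_loop t).
  elim: t => [_|t IH tN].
    by split; [exact: (@mfun_entrywise_cst R T _ (sO 0).1 n 1 0)|exact: L2_entrywise_cst].
  have [mc lc] := IH (ltnW tN); have [mf lf] := fb t tN mc lc; split.
    apply: (entrywise_sub_sigma (G := obs S t)); first exact: obs_sub.
    by apply: (mfun_entrywise_add (sO t).1); apply: (mfun_entrywise_mull (sO t).1).
  by apply: L2_entrywise_add; apply: L2_entrywise_mull.
by apply/(admissibleP hx0 hw heps) => t tN; have [mc lc] := cl t (ltnW tN); exact: fb.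
Qed.

Lemma feedback_before s : (s < k)%N -> feedback s = u s.
Proof. by move=> sk; apply/funext => om; rewrite /feedback sk. Qed.

Lemma deviation_feedback t : (k <= t < N)%N ->
  {ae P, forall om, deviation feedback t om = 0}.
Proof.
move=> /andP[kt tN].
apply: filterS (xhat_no_control hx0 hw heps hx02 hw4 feedback_admissible (ltnW tN)) => om xE.
by rewrite /deviation xE forced_feedback /feedback ltnNge kt subrr.
Qed.

Lemma control_cost_feedback : {ae P, forall om, control_cost feedback k om = 0}.
Proof.
have : {ae P, forall om, forall t, (k <= t < N)%N -> deviation feedback t om = 0}.
  apply: ae_foralln => t; have [tN|tN] := boolP (k <= t < N)%N.
    by apply: filterS (deviation_feedback tN) => om dE _.
  exact: aeW.
apply: filterS => om dE; rewrite /control_cost big_nat_cond big1// => t /andP[tN _].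
by rewrite dE// /qform mulmx0 mxE.
Qed.

End feedback.

Lemma control_cost_ge0 u k om : 0 <= control_cost u k om.
Proof.
rewrite /control_cost big_nat_cond sumr_ge0// => t /andP[/andP[_ tN] _].
exact: (posdef_possemidef (posdef_input_weight tN)).2.
Qed.

(** The control cost is nonnegative, which gives the lower bound, and it vanishes
    almost surely for the feedback law, which therefore attains the infimum. *)
Lemma optimal_cost_to_go u (p : nat -> T -> R) : admissible S N u ->
  p N = (fun om => \tr (Qmu S mus muo *m Sigma S u N om)) ->
  (forall t, (1 <= t <= N)%N ->
     p t.-1 = offset_step S mus muo (V t) (Tm t) (Sm t) (h t.-1 + l t.-1) u t (p t)) ->
  forall k, (k <= N)%N ->
    is_optimal_cost_to_go S mus muo N k u (fun om => value k (xhat S u k k om) + p k om).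
Proof.
move=> hu pN pstep k kN; have sG := sO k.
have cp := ce_error_cost hu pN pstep kN.
have cL v : admissible S N v -> (forall s, (s < k)%N -> v s = u s) ->
    ce P (obs S k) (fun om => tail_cost S mus muo N k v om - control_cost v k om)
      (fun om => value k (xhat S u k k om) + p k om).
  move=> hv vu; rewrite -(admissible_xhat hu hv kN vu).
  have cpv : ce P (obs S k) (error_cost v k) (p k).
    apply: (ce_aeL sG _ _ cp); first exact: (integrable1_measurable (integrable_error_cost hv kN)).
    by apply: filterS2 (error_cost_no_control hu kN)
      (error_cost_no_control hv kN) => om -> ->.
  have := ceD sG (ceD sG (ce_tail_cost hv kN)
    (ce_self (mfun_value hv kN) (integrable_value hv kN))) cpv.
  by congr ce; apply/funext => om; rewrite ?add0r//; ring.
have cJ v : admissible S N v ->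
    ce P (obs S k) (tail_cost S mus muo N k v)
      (cond_expect P (filt S v k) (tail_cost S mus muo N k v)).
  move=> hv; rewrite (admissible_filt hx0 hw heps hv kN).
  by apply: ce_cond_expect => //; exact: integrable_tail_cost.
split.
- have cLu := cL u hu (fun _ _ => erefl).
  exact: (mfun_wrt_measurable sG.2 (ce_mfun cLu)).
- move=> _ [v [hv vu ->]]; apply: (ce_le sG (cL v hv vu) (cJ v hv)).
  by apply: aeW => om; rewrite lerBlDr lerDl control_cost_ge0.
- move=> Z' mZ' Z'le.
  have hv := @feedback_admissible u k hu; have vu := @feedback_before u k.
  have JL : {ae P, forall om, cond_expect P (filt S (feedback u k) k)
        (tail_cost S mus muo N k (feedback u k)) om =
      value k (xhat S u k k om) + p k om}.
    apply: (ce_ae_uniq sG (cJ _ hv) (cL _ hv vu)).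
    by apply: filterS (control_cost_feedback k hu) => om ->; rewrite subr0.
  have ZJ := Z'le _ (ex_intro _ _ (And3 hv vu erefl)).
  by apply: filterS2 JL ZJ => om ->.
Qed.

(** Integrating the splitting of the cost at time 0; the constant is the expected
    value of the initial estimate plus the expected error cost. *)
Lemma lagrangianE : exists c : R, forall v, admissible S N v ->
  lagrangian S mus muo N v = (c%:E + \int[P]_om (control_cost v 0 om)%:E)%E.
Proof.
pose W v om := value 0 (xhat S v 0 0 om) + error_cost v 0 om.
have h0 := @admissible_no_control R d T P n m q S hx0 hw heps N.
have iW v : admissible S N v -> integrable1 P (W v).
  by move=> hv; apply: integrable1D; [exact: integrable_value|exact: integrable_error_cost].
exists (fine (\int[P]_om (W (@no_control R d T m) om)%:E)) => v hv.
rewrite fineK; last exact: (integrable_fin_num measurableT (iW _ h0)).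
have -> : (\int[P]_om (W (@no_control R d T m) om)%:E = \int[P]_om (W v om)%:E)%E.
  apply: integral_eq_of_ae => //; [exact: iW|exact: integrable1_measurable (iW v hv)|].
  apply: filterS (error_cost_no_control hv (leq0n N)) => om eE.
  by rewrite /W eE (@admissible_xhat _ v 0 h0 hv).
have ct := ce_tail_cost hv (leq0n N).
have icc := integrable_control_cost hv 0.
rewrite /lagrangian unlock.
transitivity (\int[P]_om ((tail_cost S mus muo N 0 v om - control_cost v 0 om
    - value 0 (xhat S v 0 0 om) - error_cost v 0 om)
    + (W v om + control_cost v 0 om))%:E)%E.
  by apply: eq_integral => om _; congr EFin; rewrite /W; ring.
rewrite integralD_EFin//; [|exact: ct.1|exact: integrable1D (iW v hv) icc].
have -> := ce_integral (sO 0) ct.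
by rewrite integral_cst_prob add0e integralD_EFin//; exact: iW.
Qed.

Lemma control_cost_eq0 u k om : control_cost u k om = 0 ->
  forall t, (k <= t < N)%N -> deviation u t om = 0.
Proof.
move=> cc0 t tN; apply/eqP/negPn/negP => d0.
have := (posdef_input_weight (proj2 (andP tN))).2 _ d0.
suff -> : qform (input_weight t) (deviation u t om) = 0 by rewrite ltxx.
have tr : t \in index_iota k N by rewrite mem_index_iota.
have qge s : s \in index_iota k N -> 0 <= qform (input_weight s) (deviation u s om).
  rewrite mem_index_iota => /andP[_ sN].
  exact: (posdef_possemidef (posdef_input_weight sN)).2.
apply/eqP; rewrite eq_le (qge _ tr) andbT -cc0 /control_cost.
rewrite (big_rem t tr)/= lerDl big_seq sumr_ge0// => s /mem_rem; exact: qge.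
Qed.

Lemma integral_control_cost_eq0 v : admissible S N v ->
  {ae P, forall om, control_cost v 0 om = 0} ->
  (\int[P]_om (control_cost v 0 om)%:E = 0)%E.
Proof.
move=> hv cc0; rewrite -[RHS](integral_cst_prob P 0).
by apply: integral_eq_of_ae => //; exact: integrable_control_cost.
Qed.

Lemma integral_control_cost_ge0 v : (0 <= \int[P]_om (control_cost v 0 om)%:E)%E.
Proof. by apply: integral_ge0 => om _; rewrite lee_fin control_cost_ge0. Qed.

Lemma risk_averse_optimal_feedback :
  risk_averse_optimal S mus muo N (feedback (@no_control R d T m) 0).
Proof.
have h0 := @admissible_no_control R d T P n m q S hx0 hw heps N.
have hf := feedback_admissible 0 h0.
have [c lE] := lagrangianE; split; first exact: hf.
move=> v hv; rewrite (lE _ hf) (lE _ hv); apply: leeD2l.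
rewrite (integral_control_cost_eq0 hf (control_cost_feedback 0 h0)).
exact: integral_control_cost_ge0.
Qed.

(** As the minimal control cost is 0 and the weights are positive definite, a
    control is optimal exactly when all its deviations vanish almost surely. *)
Lemma risk_averse_optimalP u : admissible S N u ->
  risk_averse_optimal S mus muo N u <->
  forall t, (t < N)%N -> {ae P, forall om, deviation u t om = 0}.
Proof.
move=> hu; have [c lE] := lagrangianE.
have [hf _] := risk_averse_optimal_feedback.
split=> [[_ opt] t tN|dev].
  have h0 := @admissible_no_control R d T P n m q S hx0 hw heps N.
  have := opt _ hf; rewrite (lE _ hu) (lE _ hf).
  rewrite (integral_control_cost_eq0 hf (control_cost_feedback 0 h0)).
  rewrite leeD2lE// => le0.
  have : (\int[P]_om `|(control_cost u 0 om)%:E| = 0)%E.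
    under eq_integral do rewrite abse_EFin ger0_norm ?control_cost_ge0//.
    by apply/eqP; rewrite eq_le le0 integral_control_cost_ge0.
  have mcc : measurable_fun setT (EFin \o control_cost u 0).
    by apply/measurable_EFinP; exact: integrable1_measurable (integrable_control_cost hu 0).
  move=> /(ae_eq_integral_abs P measurableT mcc); apply: filterS => om /(_ I)[cc0].
  exact: (control_cost_eq0 cc0).
split; first exact: hu.
move=> v hv; rewrite (lE _ hu) (lE _ hv); apply: leeD2l; rewrite (integral_control_cost_eq0 hu).
  exact: integral_control_cost_ge0.
have : {ae P, forall om, forall t, (t < N)%N -> deviation u t om = 0}.
  apply: ae_foralln => t; have [tN|tN] := boolP (t < N)%N.
    by apply: filterS (dev t tN) => om dE _.
  exact: aeW.
apply: filterS => om dE; rewrite /control_cost big_nat_cond big1// => t.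
by move=> /andP[/andP[_ tN] _]; rewrite dE// /qform mulmx0 mxE.
Qed.

End control.

Theorem theorem2 (R : realType) (d : measure_display) (T : measurableType d)
    (P : probability T R) (n m q : nat) (S : lq_system P n m q)
    (mus muo : R) (N : nat)
    (V Tm Sm : nat -> 'M[R]_n) (K : nat -> 'M[R]_(m, n))
    (h l : nat -> 'cV[R]_m)
    (hQ : possemidef (Q S)) (hQs : possemidef (Qs S)) (hQo : possemidef (Qo S))
    (hR : posdef (Ru S))
    (hx0 : mx_measurable measurable (x0 S))
    (hw : forall t, mx_measurable measurable (w S t))
    (heps : forall t, mx_measurable measurable (eps S t))
    (hindep : mutually_independent P (source_sigma S))
    (hid : identically_distributed P
             (fun (t : nat) (om : T) => col_mx (w S t om) (eps S t om)))
    (hx02 : square_integrable P (x0 S))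
    (hw4 : forall t, ('E_P[fun om => (norm2 (w S t om) ^+ 4)%R] < +oo)%E)
    (heps4 : forall t, ('E_P[fun om => (norm2 (eps S t om) ^+ 4)%R] < +oo)%E)
    (hmus : 0 < mus) (hmuo : 0 < muo)
    (hVN : V N = Qmu S mus muo) (hSN : Sm N = 1%:M) (hTN : Tm N = 0)
    (hK : forall t, (1 <= t <= N)%N ->
       K t.-1 = - (invmx ((B S)^T *m V t *m B S + Ru S)
                   *m (B S)^T *m V t *m A S))
    (hh : forall t, (1 <= t <= N)%N ->
       h t.-1 = - (invmx ((B S)^T *m V t *m B S + Ru S)
                   *m (B S)^T *m (V t + Tm t) *m wbar S))
    (hl : forall t, (1 <= t <= N)%N ->
       l t.-1 = - (2^-1 *: (invmx ((B S)^T *m V t *m B S + Ru S)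
                            *m (B S)^T *m Sm t *m Mmu S mus muo)))
    (hV : forall t, (1 <= t <= N)%N ->
       V t.-1 = (A S)^T *m V t *m A S + Qmu S mus muo
                - (A S)^T *m V t *m B S
                  *m invmx ((B S)^T *m V t *m B S + Ru S)
                  *m (B S)^T *m V t *m A S)
    (hT : forall t, (1 <= t <= N)%N ->
       Tm t.-1 = (A S + B S *m K t.-1)^T *m (V t + Tm t))
    (hS : forall t, (1 <= t <= N)%N ->
       Sm t.-1 = (A S + B S *m K t.-1)^T *m Sm t + 1%:M) :
  [/\ forall (u : nat -> T -> 'cV[R]_m) (p : nat -> T -> R),
        admissible S N u ->
        p N = (fun om => \tr (Qmu S mus muo *m Sigma S u N om)) ->
        (forall t, (1 <= t <= N)%N ->
           p t.-1 = offset_step S mus muo (V t) (Tm t) (Sm t)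
                      (h t.-1 + l t.-1) u t (p t)) ->
        forall t, (1 <= t <= N)%N ->
          is_optimal_cost_to_go S mus muo N t u (fun om =>
            qform (V t) (xhat S u t t om)
            + 2 * dotv (xhat S u t t om) (Tm t *m wbar S)
            + dotv (xhat S u t t om) (Sm t *m Mmu S mus muo)
            + p t om),
      exists u, risk_averse_optimal S mus muo N u &
      forall u, admissible S N u ->
        (risk_averse_optimal S mus muo N u <->
         forall t, (1 <= t <= N)%N ->
           {ae P, forall om,
              u t.-1 om = K t.-1 *m xhat S u t.-1 t.-1 om
                          + h t.-1 + l t.-1})].
Proof.
have hQmu := possemidef_Qmu hw heps hw4 heps4 hQ hQs hQo hmus hmuo.
split.
- move=> u p hu pN pstep t /andP[_ tN].
  have := optimal_cost_to_go hQmu hR hVN hSN hTN hK hh hl hV hT hS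
    hx0 hw heps hindep hid hx02 hw4 hu pN pstep tN.
  congr is_optimal_cost_to_go; apply/funext => om; congr (_ + _).
  rewrite /value /lin_coef dotvDr dotvZr mulrDr mulrA mulfV ?pnatr_eq0//.
  by rewrite mul1r addrA.
- exists (feedback S K h l (@no_control R d T m) 0).
  exact: (risk_averse_optimal_feedback hQmu hR hVN hSN hTN hK hh hl hV hT hS
    hx0 hw heps hindep hid hx02 hw4).
- move=> u hu.
  rewrite (risk_averse_optimalP hQmu hR hVN hSN hTN hK hh hl hV hT hS
    hx0 hw heps hindep hid hx02 hw4 hu).
  split=> [dev t /andP[t0 tN]|opt t tN].
    have tN' : (t.-1 < N)%N by rewrite prednK.
    apply: filterS (dev _ tN') => om /eqP.
    by rewrite /deviation subr_eq0 addrA => /eqP.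
  apply: filterS (opt t.+1 tN) => om /= uE.
  by rewrite /deviation uE addrA subrr.
Qed.
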